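(* Let $P\subseteq\mathbb{R}^d$ be a polytope that is a union of closed chambers of the hyperplane arrangement consisting of the hyperplanes $\{x_i-x_j=k\}$ ($1\le i<j\le d$, $k\in\mathbb{Z}$) and $\{x_i=k\}$ ($1\le i\le d$, $k\in\mathbb{Z}$), and let $\mathscr{T}$ be the resulting triangulation of $P$. Let a group $G$ act on $\mathbb{R}^d$ by permuting the coordinates. If $P$ is preserved by this action, then the induced action on $\mathscr{T}$ is translative and preserves a balanced proper coloring of $\mathscr{T}$. In particular, the equivariant Ehrhart series of $P$ (with respect to $\mathbb{Z}^d$) equals the equivariant Hilbert series of the Stanley–Reisner ring of $\mathscr{T}$ with the induced $G$-action, and all entries of the equivariant $h$-vector and of the equivariant flag $h$-vector (with respect to such a preserved balanced proper coloring) are effective.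
   Context: An action on a simplicial complex is translative if for every $g$ and face $\sigma$, whenever some face contains both $\sigma$ and $g\sigma$ then $g\sigma=\sigma$. A proper coloring $\gamma\colon V\to\Gamma$ assigns distinct colors to distinct vertices of each face; it is balanced if $|\Gamma|=\dim+1$; it is preserved if $\gamma(gv)=\gamma(v)$. Equivariant Ehrhart series: for a lattice polytope $P$ invariant under a linear permutation action, $\mathrm{Ehr}(P;t)=1+\sum_{m\ge1}\chi_{mP}t^m$, $\chi_{mP}$ the permutation character on $mP\cap\mathbb{Z}^d$. Stanley–Reisner ring $\mathbb{C}[\Sigma]=\mathbb{C}[x_v]/(x_{v_1}\cdots x_{v_k}:\{v_1,\dots,v_k\}\notin\Sigma)$ with $x_v\mapsto x_{gv}$, equivariant Hilbert series $\sum_i\chi_{\mathbb{C}[\Sigma]_i}t^i$. Equivariant $h$-vector of a $D$-dimensional complex: $\mathfrak{h}_k=\sum_{i=0}^k(-1)^{k-i}\binom{D+1-i}{k-i}\mathfrak{f}_{i-1}$ where $\mathfrak{f}_{i-1}$ is the permutation character on $(i-1)$-faces ($\mathfrak{f}_{-1}=1$); equivariant flag $h$-vector: $\mathfrak{h}_S=\sum_{T\subseteq S}(-1)^{|S|-|T|}\mathfrak{f}_T$ with $\mathfrak{f}_T$ the permutation character on faces with color set exactly $T$. Effective: nonnegative integer combination of irreducible complex characters. *)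

(* Defs.v *)
From HB Require Import structures.
From mathcomp Require Import all_boot all_order all_algebra all_fingroup.
From mathcomp Require Import finmap mpoly complex.
From mathcomp Require Import boolp classical_sets functions cardinality.
From mathcomp Require Import reals topology.

Set Implicit Arguments.
Unset Strict Implicit.
Unset Printing Implicit Defensive.

Import Order.TTheory GRing.Theory Num.Theory.
Import numFieldTopology.Exports.

Local Open Scope ring_scope.

(** * Finite simplicial complexes and families of maps on their vertices *)

(* Vertices are not required to be faces; the empty set always is one, so the
   smallest complex is [{set0}], of dimension -1. *)
Record scomplex (V : finType) := SComplex {
  faces :> {set {set V}};
  faces0 : finset.set0 \in faces;
  faces_sub : forall s t : {set V}, t \in faces -> s \subset t -> s \in faces
}.

(* dim + 1 *)
Definition crank (V : finType) (K : scomplex V) : nat :=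
  (\max_(s in faces K) #|s|)%N.

(* An action is passed as the family [act] of its maps [act g : V -> V]. *)
Definition translative (V : finType) (K : scomplex V) (G : Type)
    (act : G -> V -> V) : Prop :=
  forall (g : G) (s : {set V}), s \in faces K ->
    (exists2 t, t \in faces K & (s \subset t) && (act g @: s \subset t)) ->
    act g @: s = s.

Definition proper_coloring (V : finType) (K : scomplex V) (Gam : finType)
    (gam : V -> Gam) : Prop :=
  forall s, s \in faces K -> {in s &, injective gam}.

Definition balanced (V : finType) (K : scomplex V) (Gam : finType) : Prop :=
  #|Gam| = crank K.

Definition preserves_coloring (V : finType) (G : Type) (act : G -> V -> V)
    (Gam : finType) (gam : V -> Gam) : Prop :=
  forall g v, gam (act g v) = gam v.

(** * Characters *)

(* The group [G] may be infinite, so [mx_representation] and ['CF(G)], which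
   are only available for finite groups, cannot be used. *)
Definition is_rep (F : fieldType) (G : groupType) (n : nat)
    (r : G -> 'M[F]_n) : Prop :=
  r 1%g = 1%:M /\ forall g h : G, r (g * h)%g = r g *m r h.

(* [U] ranges over all subspaces of ['rV_n], as row spaces of matrices. *)
Definition irreducible_rep (F : fieldType) (G : groupType) (n : nat)
    (r : G -> 'M[F]_n) : Prop :=
  [/\ is_rep r, (0 < n)%N &
      forall U : 'M[F]_n, (forall g, stablemx U (r g)) ->
        U = 0 \/ row_full U].

Definition irreducible_character (F : fieldType) (G : groupType)
    (chi : G -> F) : Prop :=
  exists n (r : G -> 'M[F]_n), irreducible_rep r /\ chi = fun g => \tr (r g).

Definition effective (F : fieldType) (G : groupType) (f : G -> F) : Prop :=
  exists n (m : 'I_n -> nat) (chi : 'I_n -> G -> F),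
    (forall i, irreducible_character (chi i)) /\
    f = fun g => \sum_(i < n) (m i)%:R * chi i g.

(** * Equivariant [h]-vectors and flag [h]-vectors *)

Section HVectors.
Variables (F : fieldType) (V : finType) (K : scomplex V).
Variables (G : Type) (act : G -> V -> V).

(* [equiv_f i] is the permutation character on the faces of cardinality [i],
   i.e. of dimension [i - 1]. *)
Definition equiv_f (i : nat) (g : G) : F :=
  #|[set s in faces K | (#|s| == i) && (act g @: s == s)]|%:R.

Definition equiv_h (k : nat) (g : G) : F :=
  \sum_(0 <= i < k.+1)
    (-1) ^+ (k - i) * 'C(crank K - i, k - i)%:R * equiv_f i g.

Variables (Gam : finType) (gam : V -> Gam).

Definition equiv_flag_f (T : {set Gam}) (g : G) : F :=
  #|[set s in faces K | (gam @: s == T) && (act g @: s == s)]|%:R.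

Definition equiv_flag_h (S : {set Gam}) (g : G) : F :=
  \sum_(T : {set Gam} | T \subset S)
    (-1) ^+ (#|S| - #|T|) * equiv_flag_f T g.

End HVectors.

(** * Stanley-Reisner rings *)

Section StanleyReisner.
Variables (F : fieldType) (V : finType).

Definition vvar (v : V) : {mpoly F[#|V|]} := 'X_(enum_rank v).

Variable K : scomplex V.

(* The ideal generated by the squarefree monomials of the non-faces. *)
Definition sr_ideal : {pred {mpoly F[#|V|]}} := fun p =>
  `[< exists q : {set V} -> {mpoly F[#|V|]},
        p = \sum_(s : {set V} | s \notin faces K) q s * \prod_(v in s) vvar v >].

Lemma sr_ideal_closed : idealr_closed sr_ideal.
Proof.
split.
- by apply/asboolP; exists (fun=> 0); rewrite big1 // => s _; rewrite mul0r.
- apply/negP => /asboolP[q /(congr1 (meval (fun=> 0)))].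
  rewrite meval1 rmorph_sum big1 /= => [/eqP|s sK]; first by rewrite oner_eq0.
  have [v vs] : exists v, v \in s.
    apply/set0Pn; apply: contraNneq sK => ->; exact: faces0.
  by rewrite mevalM rmorph_prod (bigD1 v) //= mevalXU mul0r mulr0.
- move=> a x y /asboolP[p ->] /asboolP[q ->]; apply/asboolP.
  exists (fun s => a * p s + q s).
  rewrite big_distrr -big_split /=; apply: eq_bigr => s _.
  by rewrite mulrDl mulrA.
Qed.

HB.instance Definition _ := isIdealr.Build _ sr_ideal sr_ideal_closed.

Definition sr_ring : Type := {ideal_quot sr_ideal}.
HB.instance Definition _ := GRing.ComNzRing.on sr_ring.

Definition sr_pi (p : {mpoly F[#|V|]}) : sr_ring :=
  (\pi_{ideal_quot sr_ideal} p)%qT.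

Fact sr_pi_is_zmod_morphism : zmod_morphism sr_pi.
Proof. exact: raddfB. Qed.
HB.instance Definition _ :=
  GRing.isZmodMorphism.Build _ _ sr_pi sr_pi_is_zmod_morphism.

Fact sr_pi_is_monoid_morphism : monoid_morphism sr_pi.
Proof. by split; [exact: rmorph1 | exact: rmorphM]. Qed.
HB.instance Definition _ :=
  GRing.isMonoidMorphism.Build _ _ sr_pi sr_pi_is_monoid_morphism.

Definition sr_scale (c : F) (q : sr_ring) : sr_ring := sr_pi c%:MP * q.

Fact sr_scaleA a b q : sr_scale a (sr_scale b q) = sr_scale (a * b) q.
Proof. by rewrite /sr_scale mulrA -rmorphM /= -mpolyCM. Qed.
Fact sr_scale1 : left_id 1 sr_scale.
Proof. by move=> q; rewrite /sr_scale mpolyC1 rmorph1 mul1r. Qed.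
Fact sr_scaleDr : right_distributive sr_scale +%R.
Proof. by move=> a p q; rewrite /sr_scale mulrDr. Qed.
Fact sr_scaleDl q : {morph sr_scale^~ q : a b / a + b}.
Proof. by move=> a b; rewrite /sr_scale mpolyCD rmorphD mulrDl. Qed.
HB.instance Definition _ := GRing.Zmodule_isLmodule.Build F sr_ring
  sr_scaleA sr_scale1 sr_scaleDr sr_scaleDl.

Definition sr_graded (m : nat) : set sr_ring :=
  [set sr_pi p | p in [set p : {mpoly F[#|V|]} | p \is m.-homog]]%classic.

(* The substitution [x_v := x_(f v)]. *)
Definition vpoly_act (f : V -> V) (p : {mpoly F[#|V|]}) : {mpoly F[#|V|]} :=
  p \mPo [tuple vvar (f (enum_val i)) | i < #|V|].

(* Independent of the representative as soon as [vpoly_act f] maps the ideal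
   into itself, in particular when [f] is an automorphism of [K]. *)
Definition sr_act (f : V -> V) (q : sr_ring) : sr_ring :=
  sr_pi (vpoly_act f (generic_quotient.repr q)).

End StanleyReisner.

(* [t] is the trace of the endomorphism induced by [f] on the finite
   dimensional subspace [W]. *)
Definition is_trace_on (F : fieldType) (M : lmodType F) (W : set M)
    (f : M -> M) (t : F) : Prop :=
  exists n (e : 'I_n -> M) (A : 'M[F]_n),
    [/\ forall i, W (e i),
        forall w, W w -> exists c : 'I_n -> F, w = \sum_(i < n) c i *: e i,
        forall c : 'I_n -> F,
          \sum_(i < n) c i *: e i = 0 -> forall i, c i = 0,
        forall j, f (e j) = \sum_(i < n) A i j *: e i &
        t = \tr A].

Definition trace_on (F : fieldType) (M : lmodType F) (W : set M)
    (f : M -> M) : F :=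
  xget 0 [set t | is_trace_on W f t]%classic.

(* The series [\sum_m chi_m t^m] is represented by the sequence [chi]. *)
Definition equiv_hilbert_series (F : fieldType) (V : finType) (K : scomplex V)
    (G : Type) (act : G -> V -> V) (m : nat) (g : G) : F :=
  trace_on (@sr_graded F V K m) (sr_act (act g)).

(** * Unions of alcoves in [R^d] *)

Section Alcoved.
Variables (R : realType) (d : nat).
Local Open Scope classical_set_scope.

Definition polytope (P : set 'rV[R]_d) : Prop :=
  exists n (p : 'I_n -> 'rV[R]_d),
    P = [set x | exists w : 'I_n -> R,
           [/\ forall i, 0 <= w i, \sum_(i < n) w i = 1 &
               x = \sum_(i < n) w i *: p i]].

Definition arrangement : set (set 'rV[R]_d) :=
  [set H | (exists (i j : 'I_d) (k : int), (i < j)%N /\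
              H = [set x : 'rV[R]_d | x ord0 i - x ord0 j = k%:~R]) \/
           (exists (i : 'I_d) (k : int), H = [set x : 'rV[R]_d | x ord0 i = k%:~R])].

Definition arrangement_complement : set 'rV[R]_d :=
  ~` \bigcup_(H in arrangement) H.

Definition chambers : set (set 'rV[R]_d) :=
  [set C | exists2 x, arrangement_complement x &
             C = connected_component arrangement_complement x].

Definition union_of_closed_chambers (P : set 'rV[R]_d) : Prop :=
  exists2 Cs, Cs `<=` chambers & P = \bigcup_(C in Cs) closure C.

Definition extreme_point (A : set 'rV[R]_d) (v : 'rV[R]_d) : Prop :=
  A v /\ forall x y (t : R), A x -> A y -> 0 < t < 1 ->
           v = t *: x + (1 - t) *: y -> x = y.

(* The vertices of the chambers contained in [P]; there are finitely many of
   them if [P] is bounded ([fset_set] is [fset0] on infinite sets). *)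
Definition tri_vertices (P : set 'rV[R]_d) : {fset 'rV[R]_d} :=
  fset_set [set v | exists C, [/\ chambers C, closure C `<=` P &
                                  extreme_point (closure C) v]].

(* The closed chambers are simplices, hence the faces of a closed chamber are
   given by the subsets of its set of vertices. *)
Definition tri_faces (P : set 'rV[R]_d) : {set {set tri_vertices P}} :=
  [set s | (s == finset.set0) ||
     `[< exists C, [/\ chambers C, closure C `<=` P &
           forall v, v \in s -> extreme_point (closure C) (val v)] >]]%SET.

Fact tri_faces0 P : finset.set0 \in tri_faces P.
Proof. by rewrite inE eqxx. Qed.

Fact tri_faces_sub P (s t : {set tri_vertices P}) :
  t \in tri_faces P -> s \subset t -> s \in tri_faces P.
Proof.
rewrite !inE => /orP[/eqP-> | /asboolP[C [chC CP Ct]] st].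
  by rewrite finset.subset0 => ->.
apply/orP; right; apply/asboolP; exists C; split=> // v vs.
by apply: Ct; exact: (fintype.subsetP st).
Qed.

Definition triangulation (P : set 'rV[R]_d) : scomplex (tri_vertices P) :=
  SComplex (tri_faces0 P) (@tri_faces_sub P).

(* As permutations compose from left to right in ['S_d], this is a left action:
   [coord_act (s * t) x = coord_act s (coord_act t x)]. *)
Definition coord_act (s : 'S_d) (x : 'rV[R]_d) : 'rV[R]_d := col_perm s x.

(* If [coord_act s] preserves [P], it maps vertices to vertices and
   [insubd] never uses its default value. *)
Definition tri_act (P : set 'rV[R]_d) (s : 'S_d) (v : tri_vertices P) :
    tri_vertices P :=
  insubd v (coord_act s (val v)).

Definition lattice_point (x : 'rV[R]_d) : Prop :=
  forall i, x ord0 i \is a Num.int.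

Definition dilate (m : nat) (P : set 'rV[R]_d) : set 'rV[R]_d :=
  [set m%:R *: x | x in P].

Section Ehrhart.
Variables (F : fieldType) (G : Type) (act : G -> 'rV[R]_d -> 'rV[R]_d).

(* The permutation character on the lattice points of [A]. *)
Definition lattice_character (A : set 'rV[R]_d) (g : G) : F :=
  #|` fset_set [set x | [/\ A x, lattice_point x & act g x = x]]|%:R.

Definition equiv_ehrhart_series (P : set 'rV[R]_d) (m : nat) (g : G) : F :=
  if m == 0%N then 1 else lattice_character (dilate m P) g.

End Ehrhart.

End Alcoved.

Arguments tri_act {R d} P s v.

(* Main.v *)
(* With the extra coordinate [x_None = 0], the alcove of a generic point [x] is
   determined by the integers [floor (x_i - x_j)], and its vertices are the
   lattice points of its closure. The sum of the coordinates modulo [d + 1] is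
   a proper coloring, invariant under permutations of the coordinates, and an
   action that preserves a proper coloring is translative.

   A lattice point [z] of [m P] is the sum of its [m] roundings
   [floor ((z + j) / m)], [0 <= j < m], which are vertices of one alcove, and
   this multiset is the only multiset of [m] vertices of an alcove with sum
   [z]. Hence the lattice points of [m P] correspond equivariantly to the
   monomials of degree [m] supported on faces.

   Ordering the alcoves of [P] by the number of hyperplanes that separate them
   from a fixed alcove is a shelling: each facet [C] has a restriction face
   [Rs C], and each face [s] satisfies [Rs C \subset s \subset C] for a unique
   [C]. Consider functions on the facets, and for each set [S] of colors the
   stable subspace [W_S] of the functions that only depend on the face of
   color [S]; its character is [f_S]. The indicator functions of the facets
   containing [Rs C], for those [C] such that the colors of [Rs C] lie in [S],
   form a basis of [W_S], for every [S]. So the action is block triangular in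
   the basis of all these functions, and by Moebius inversion the diagonal
   block of color set [S] is a representation with character [h_S]. *)

Require Import Defs.
From mathcomp Require Import all_boot all_order all_algebra all_fingroup.
From mathcomp Require Import finmap complex.
From mathcomp Require Import mpoly.
From mathcomp Require Import boolp classical_sets functions cardinality.
From mathcomp Require Import reals topology.
From mathcomp Require mxrepresentation matrix_normedtype normed_module.
From mathcomp Require Import zify ring lra.
Import Order.TTheory GRing.Theory Num.Theory.
Import numFieldTopology.Exports.
Local Open Scope ring_scope.

Set Implicit Arguments.
Unset Strict Implicit.
Unset Printing Implicit Defensive.

(** * Traces *)

Section Traces.
Variables (F : fieldType) (M : lmodType F).

Definition lin_free (I : finType) (e : I -> M) : Prop :=
  forall c : I -> F, \sum_i c i *: e i = 0 -> forall i, c i = 0.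

Definition lin_comb (I : finType) (e : I -> M) (w : M) : Prop :=
  exists c : I -> F, w = \sum_i c i *: e i.

Lemma lin_free_eq (I : finType) (e : I -> M) (c c' : I -> F) :
  lin_free e -> \sum_i c i *: e i = \sum_i c' i *: e i -> c =1 c'.
Proof.
move=> fe /eqP; rewrite -subr_eq0 -sumrB => /eqP cc' i; apply/eqP.
rewrite -subr_eq0; apply/eqP; apply: (fe (fun i => c i - c' i)).
by rewrite -[RHS]cc'; apply: eq_bigr => j _; rewrite scalerBl.
Qed.

Lemma lin_combD (I : finType) (e : I -> M) (w w' : M) :
  lin_comb e w -> lin_comb e w' -> lin_comb e (w + w').
Proof.
move=> [c ->] [c' ->]; exists (fun i => c i + c' i); rewrite -big_split.
by apply: eq_bigr => i _; rewrite scalerDl.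
Qed.

Lemma lin_combZ (I : finType) (e : I -> M) (a : F) (w : M) :
  lin_comb e w -> lin_comb e (a *: w).
Proof.
move=> [c ->]; exists (fun i => a * c i); rewrite scaler_sumr.
by apply: eq_bigr => i _; rewrite scalerA.
Qed.

Lemma lin_comb_sum (I J : finType) (e : I -> M) (c : J -> F) (w : J -> M) :
  (forall j, c j != 0 -> lin_comb e (w j)) -> lin_comb e (\sum_j c j *: w j).
Proof.
move=> ew; elim/big_ind: _ => [||j _]; last 1 first.
- have [->|/ew] := eqVneq (c j) 0; last exact: lin_combZ.
  rewrite scale0r; exists (fun=> 0).
  by rewrite big1 // => i _; rewrite scale0r.
- by exists (fun=> 0); rewrite big1 // => i _; rewrite scale0r.
- by move=> w1 w2; apply: lin_combD.
Qed.

Lemma linear_sumZ (f : M -> M) (I : finType) (c : I -> F) (e : I -> M) :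
  linear f -> f (\sum_i c i *: e i) = \sum_i c i *: f (e i).
Proof.
move=> lf; have f0 : f 0 = 0.
  have := lf 1 0 0; rewrite !scale1r addr0 => /eqP.
  by rewrite -subr_eq subrr eq_sym => /eqP.
by elim/big_rec2: _ => // i x y _ <-; rewrite lf.
Qed.

(** The change-of-basis matrices [b] and [c] are inverse to each other and intertwine [A] with [A'].
    The index types may differ, so no equality of dimensions has to be known beforehand. *)
Lemma trace_basis_change (f : M -> M) (I J : finType) (e : I -> M)
    (e' : J -> M) (A : I -> I -> F) (A' : J -> J -> F) :
  linear f -> lin_free e -> lin_free e' ->
  (forall j, lin_comb e (e' j)) -> (forall i, lin_comb e' (e i)) ->
  (forall j, f (e j) = \sum_i A i j *: e i) ->
  (forall j, f (e' j) = \sum_i A' i j *: e' i) ->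
  \sum_i A i i = \sum_j A' j j.
Proof.
move=> lf fe fe' /choice[b bE] /choice[c cE] AE A'E.
have bc i k : \sum_j b j i * c k j = (i == k)%:R.
  have := @lin_free_eq _ _ (fun i => \sum_j b j i * c k j)
            (fun i => (i == k)%:R) fe _ i; apply.
  rewrite [RHS](bigD1 k) //= eqxx scale1r [X in _ + X]big1 ?addr0 => [|l /negbTE->];
    last by rewrite scale0r.
  rewrite [RHS]cE; under [RHS]eq_bigr do rewrite bE scaler_sumr.
  rewrite exchange_big; apply: eq_bigr => l _; rewrite scaler_suml.
  by apply: eq_bigr => j _; rewrite scalerA mulrC.
have cb i k : \sum_j c j i * b k j = (i == k)%:R.
  have := @lin_free_eq _ _ (fun i => \sum_j c j i * b k j)
            (fun i => (i == k)%:R) fe' _ i; apply.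
  rewrite [RHS](bigD1 k) //= eqxx scale1r [X in _ + X]big1 ?addr0 => [|l /negbTE->];
    last by rewrite scale0r.
  rewrite [RHS]bE; under [RHS]eq_bigr do rewrite cE scaler_sumr.
  rewrite exchange_big; apply: eq_bigr => l _; rewrite scaler_suml.
  by apply: eq_bigr => j _; rewrite scalerA mulrC.
have Ab i j : \sum_k A i k * b j k = \sum_k A' k j * b k i.
  have := @lin_free_eq _ _ (fun i => \sum_k A i k * b j k)
            (fun i => \sum_k A' k j * b k i) fe _ i; apply.
  transitivity (f (e' j)).
    rewrite bE linear_sumZ //; under [RHS]eq_bigr do rewrite AE scaler_sumr.
    rewrite exchange_big; apply: eq_bigr => l _; rewrite scaler_suml.
    by apply: eq_bigr => k _; rewrite scalerA mulrC.
  rewrite A'E; under eq_bigr do rewrite bE scaler_sumr.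
  rewrite exchange_big; apply: eq_bigr => l _; rewrite scaler_suml.
  by apply: eq_bigr => k _; rewrite scalerA.
transitivity (\sum_i \sum_k A i k * \sum_j b j k * c i j).
  apply: eq_bigr => i _; rewrite (bigD1 i) //= bc eqxx mulr1 big1 ?addr0 // => k.
  by move=> /negbTE ki; rewrite bc ki mulr0.
transitivity (\sum_j \sum_k A' k j * \sum_i c i j * b k i); last first.
  apply: eq_bigr => i _; rewrite (bigD1 i) //= cb eqxx mulr1 big1 ?addr0 // => k.
  by move=> /negbTE ki; rewrite cb eq_sym ki mulr0.
transitivity (\sum_i \sum_j c i j * \sum_k A i k * b j k).
  apply: eq_bigr => i _; under eq_bigr do rewrite mulr_sumr.
  rewrite exchange_big; apply: eq_bigr => j _; rewrite mulr_sumr.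
  by apply: eq_bigr => k _; ring.
rewrite exchange_big; apply: eq_bigr => j _.
under eq_bigr do rewrite Ab mulr_sumr.
rewrite exchange_big; apply: eq_bigr => k _; rewrite mulr_sumr.
by apply: eq_bigr => i _; ring.
Qed.

(** Frees [trace_on] from the basis that [xget] chooses: any basis of [W], indexed by any finite
    type, computes it. *)
Lemma trace_onE (W : set M) (f : M -> M) (I : finType) (e : I -> M)
    (A : I -> I -> F) :
  linear f -> (forall i, W (e i)) -> (forall w, W w -> lin_comb e w) ->
  lin_free e -> (forall j, f (e j) = \sum_i A i j *: e i) ->
  trace_on W f = \sum_i A i i.
Proof.
move=> lf We eW fe fE.
have tr : is_trace_on W f (\sum_i A i i).
  exists #|I|, (fun i => e (enum_val i)),
    (\matrix_(i, j) A (enum_val i) (enum_val j)); split => //.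
  - move=> w /eW[c ->]; exists (fun i => c (enum_val i)).
    by rewrite [LHS](reindex_onto enum_val enum_rank) //= => [|i _];
      rewrite ?enum_rankK //; apply: eq_bigl => i; rewrite enum_valK eqxx.
  - move=> c c0 i; rewrite -(enum_valK i).
    apply: (fe (fun i => c (enum_rank i))); rewrite -[RHS]c0.
    by rewrite [LHS](reindex_onto enum_val enum_rank) //= => [|j _];
      rewrite ?enum_rankK //; apply: eq_big => [j|j _]; rewrite enum_valK ?eqxx.
  - move=> j; rewrite fE.
    rewrite [LHS](reindex_onto enum_val enum_rank) //= => [|i _];
      last by rewrite enum_rankK.
    by apply: eq_big => [i|i _]; rewrite ?enum_valK ?eqxx ?mxE.
  - rewrite [LHS](reindex_onto enum_val enum_rank) //= => [|i _];
      last by rewrite enum_rankK.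
    by apply: eq_big => [i|i _]; rewrite ?enum_valK ?eqxx ?mxE.
(* The witness [tr] makes the set searched by [xget] nonempty, so [trace_on] is the trace in some
   basis [e']. *)
have [n [e' [A' [We' e'W fe' fE' ->]]]] : is_trace_on W f (trace_on W f).
  exact: (xgetPex 0 (ex_intro _ _ tr)).
by symmetry; apply: (trace_basis_change lf fe fe') => // i;
  [apply: eW | apply: e'W].
Qed.

End Traces.

(** * Effective characters *)

Section Effective.
Variables (F : fieldType) (G : groupType).

Lemma effectiveD (f1 f2 : G -> F) :
  effective f1 -> effective f2 -> effective (fun g => f1 g + f2 g).
Proof.
move=> [n1 [m1 [chi1 [irr1 ->]]]] [n2 [m2 [chi2 [irr2 ->]]]].
exists (n1 + n2)%N,
  (fun i => match fintype.split i with inl j => m1 j | inr j => m2 j end),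
  (fun i => match fintype.split i with inl j => chi1 j | inr j => chi2 j end).
split=> [i|]; first by case: (fintype.split i).
apply/funext => g; rewrite big_split_ord /=; congr (_ + _).
  by apply: eq_bigr => i _; rewrite (unsplitK (inl _ i)).
by apply: eq_bigr => i _; rewrite (unsplitK (inr _ i)).
Qed.

Lemma effective0 : effective (fun _ : G => 0 : F).
Proof.
exists 0%N, (fun=> 0%N), (fun=> fun=> 0); split=> [[]//|].
by apply/funext => g; rewrite big_ord0.
Qed.

Lemma effective_sum (I : finType) (P : pred I) (f : I -> G -> F) :
  (forall i, P i -> effective (f i)) ->
  effective (fun g => \sum_(i | P i) f i g).
Proof.
move=> ef; have -> : (fun g => \sum_(i | P i) f i g) =
    \big[(fun f1 f2 : G -> F => fun g => f1 g + f2 g)/(fun=> 0)]_(i | P i) f i.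
  by apply/funext => g; elim/big_rec2: _ => // i x y _ ->.
by elim/big_ind: _ => //; [exact: effective0 | move=> ? ?; exact: effectiveD].
Qed.

(** * Representations on a stable subspace and on its quotient *)

Section StableSubspace.
Variables (n : nat) (r : G -> 'M[F]_n) (U : 'M[F]_n).
Hypotheses (rep_r : is_rep r) (stabU : forall g, stablemx U (r g)).

Import mxrepresentation.

Definition sub_mx g := in_submod U (val_submod (U := U) 1%:M *m r g).
Definition quot_mx g := in_factmod U (val_factmod (U := U) 1%:M *m r g).

Let v := val_submod (U := U) 1%:M.
Let w := val_factmod (U := U) 1%:M.

Let subU m (A : 'M_(m, n)) g : (A <= U)%MS -> (A *m r g <= U)%MS.
Proof. by move=> AU; apply: submx_trans (submxMr _ AU) (stabU g). Qed.

Lemma sub_rep : is_rep sub_mx.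
Proof.
case: rep_r => r1 rM; split=> [|g h].
  by rewrite /sub_mx -/v r1 mulmx1 val_submodK.
rewrite {1}/sub_mx -/v rM mulmxA.
have vU : (v *m r g <= U)%MS by apply/subU/val_submodP.
have -> : v *m r g = sub_mx g *m v by rewrite -val_submodE in_submodK.
by rewrite -mulmxA in_submodE -mulmxA -in_submodE.
Qed.

Lemma quot_rep : is_rep quot_mx.
Proof.
case: rep_r => r1 rM; split=> [|g h].
  by rewrite /quot_mx -/w r1 mulmx1 val_factmodK.
rewrite {1}/quot_mx -/w rM mulmxA -{1}(add_sub_fact_mod U (w *m r g)) mulmxDl.
rewrite linearD /= [X in X + _](_ : _ = 0) ?add0r.
  by rewrite [val_factmod _]val_factmodE -mulmxA in_factmodE -mulmxA -in_factmodE.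
by apply/eqP; rewrite in_factmod_eq0; apply/subU/val_submodP.
Qed.

(** The identity is the sum of a projection onto [U] and a projection onto a complement. Each
    factors through its coordinate space, and cyclicity of the trace turns the two summands into the
    smaller traces. *)
Lemma trace_sub_quot g : \tr (r g) = \tr (sub_mx g) + \tr (quot_mx g).
Proof.
rewrite -{1}(mul1mx (r g)) -{1}(add_sub_fact_mod U 1%:M).
rewrite val_submodE -/v val_factmodE -/w mulmxDl mxtraceD.
rewrite /sub_mx -/v /quot_mx -/w.
rewrite [in_submod U (_ *m _)]in_submodE [in_factmod U (_ *m _)]in_factmodE.
rewrite -(mulmxA (in_submod _ _) v) -(mulmxA (in_factmod _ _) w).
by congr (_ + _); exact: mxtrace_mulC.
Qed.

End StableSubspace.

(* A composition series suffices: complete reducibility is not needed. *)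
Lemma effective_trace n (r : G -> 'M[F]_n) :
  is_rep r -> effective (fun g => \tr (r g)).
Proof.
have [N] := ubnP n; elim: N => // N IH in n r *; rewrite ltnS => nN rep_r.
have [n0 | n_gt0] := posnP n.
  rewrite (_ : (fun _ => _) = fun=> 0); first exact: effective0.
  by apply/funext => g; rewrite /mxtrace big1 // => k; have := ltn_ord k; rewrite {2}n0.
have [irr|nirr] := pselect (irreducible_rep r).
  exists 1%N, (fun=> 1%N), (fun=> fun g => \tr (r g)).
  split=> [_|]; first by exists n, r.
  by apply/funext => g; rewrite big_ord1 mul1r.
(* As [n] is positive, irreducibility fails only through a proper nonzero stable subspace; it and
   its quotient both have smaller dimension. *)
have [U [stabU U0 UT]] : exists U : 'M_n,
    [/\ forall g, stablemx U (r g), U != 0 & ~~ row_full U].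
  apply: contrapT => nU; apply: nirr; split=> // U stabU.
  have [->|U0] := eqVneq U 0; first by left.
  right; apply: contrapT => /negP UT; by apply: nU; exists U.
rewrite (funext (trace_sub_quot r U)).
have rkU : (\rank U < n)%N by rewrite ltn_neqAle rank_leq_row andbT.
apply: (@effectiveD (fun g => \tr (sub_mx r U g)) (fun g => \tr (quot_mx r U g)));
  apply: IH.
- exact: leq_trans rkU nN.
- exact: sub_rep.
- rewrite mxrank_coker; have : (0 < \rank U)%N by rewrite lt0n mxrank_eq0.
  by lia.
- exact: quot_rep.
Qed.

Lemma effective_trace_fin (I : finType) (a : G -> I -> I -> F) :
  (forall i j, a 1%g i j = (i == j)%:R) ->
  (forall g h i j, a (g * h)%g i j = \sum_k a g i k * a h k j) ->
  effective (fun g => \sum_i a g i i).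
Proof.
move=> a1 aM.
pose r g : 'M_#|I| := \matrix_(i, j) a g (enum_val i) (enum_val j).
have enumE (E : I -> F) : \sum_i E i = \sum_(i < #|I|) E (enum_val i).
  rewrite [LHS](reindex_onto enum_val enum_rank) //= => [|i _];
    last by rewrite enum_rankK.
  by apply: eq_bigl => i; rewrite enum_valK eqxx.
rewrite (_ : (fun _ => _) = fun g => \tr (r g)); last first.
  by apply/funext => g; rewrite enumE; apply: eq_bigr => i _; rewrite mxE.
apply: effective_trace; split=> [|g h]; apply/matrixP => i j; rewrite !mxE.
  by rewrite a1 (inj_eq enum_val_inj).
by rewrite aM enumE; apply: eq_bigr => k _; rewrite !mxE.
Qed.

End Effective.

(** * Colorings and flag [h]-vectors *)

(** Toggling a fixed [x] in [S] outside [U] pairs the sets of the interval with opposite signs. *)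
Lemma sum_interval_sign (F : nzRingType) (T : finType) (U S : {set T}) :
  U \subset S ->
  \sum_(W : {set T} | (U \subset W) && (W \subset S))
    (-1) ^+ (#|S| - #|W|) = (U == S)%:R :> F.
Proof.
move=> US; have [->|neUS] := eqVneq U S.
  rewrite (big_pred1 S) ?subnn // => W /=.
  by rewrite finset.eqEsubset andbC.
have /properP[_ [x xS xU]] : U \proper S by rewrite finset.properEneq neUS.
rewrite (bigID (fun W : {set T} => x \in W)) /=.
rewrite (reindex_onto (fun W => x |: W) (fun W => W :\ x)) /=; last first.
  by move=> W /andP[_ xW]; rewrite finset.setD1K.
rewrite [X in _ + X](eq_big
    (fun W => (U \subset x |: W) && (x |: W \subset S) && (x \in x |: W)
              && ((x |: W) :\ x == W))
    (fun W => - (-1) ^+ (#|S| - #|x |: W|))).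
- by rewrite sumrN subrr.
- move=> W; rewrite finset.setU11 andbT; apply/andP/andP=> [[/andP[UW WS] xW]|].
    split; last by rewrite finset.setU1K.
    rewrite finset.subUset finset.sub1set xS WS !andbT.
    exact: fintype.subset_trans UW (finset.subsetUr _ _).
  move=> [/andP[UW WS] /eqP <-]; rewrite finset.setD11; split=> //; apply/andP; split.
    by rewrite finset.subsetD1 UW xU.
  exact: fintype.subset_trans (finset.subD1set _ _) WS.
- move=> W /andP[/andP[UW WS] xW]; rewrite finset.cardsU1 xW /=.
  have : (#|x |: W| <= #|S|)%N.
    by apply: subset_leq_card; rewrite finset.subUset finset.sub1set xS.
  rewrite finset.cardsU1 xW /= => WltS.
  have -> : (#|S| - #|W| = (#|S| - (1 + #|W|)).+1)%N by lia.
  by rewrite exprS mulN1r.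
Qed.

Section Coloring.
Variables (V : finType) (K : scomplex V).

(** Full cardinality is required, not mere maximality under inclusion: with a balanced proper
    coloring, a facet then carries every color. *)
Definition facet (C : {set V}) := (C \in faces K) && (#|C| == crank K).

Variables (Gam : finType) (gam : V -> Gam).
Hypotheses (proper_gam : proper_coloring K gam) (bal : balanced K Gam).

Lemma card_colors s : s \in faces K -> #|gam @: s| = #|s|.
Proof. by move=> sK; rewrite card_in_imset //; exact: proper_gam. Qed.

Lemma colors_facet C : facet C -> gam @: C = finset.setT.
Proof.
move=> /andP[CK /eqP Ccr]; apply/eqP.
by rewrite finset.eqEcard finset.subsetT cardsT bal card_colors // Ccr leqnn.
Qed.

(** For a facet [C], this is the only face of [C] with color set [S]. *)
Definition restr (C : {set V}) (S : {set Gam}) := [set v in C | gam v \in S]%SET.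

Lemma restr_sub C S : restr C S \subset C.
Proof. by apply/fintype.subsetP => v; rewrite inE => /andP[]. Qed.

Lemma restr_face C S : facet C -> restr C S \in faces K.
Proof. by case/andP => CK _; exact: faces_sub CK (restr_sub C S). Qed.

Lemma colors_restr C S : facet C -> gam @: restr C S = S.
Proof.
move=> fC; apply/setP => c; apply/imsetP/idP => [[v + ->]|cS].
  by rewrite inE => /andP[].
have : c \in gam @: C by rewrite colors_facet // inE.
by case/imsetP => v vC cE; exists v; rewrite // inE vC -cE.
Qed.

Lemma restr_unique C S (t : {set V}) :
  facet C -> t \subset C -> gam @: t = S -> t = restr C S.
Proof.
move=> /andP[CK _] tC tS; apply/setP => v; rewrite inE; apply/idP/andP.
  by move=> vt; rewrite -tS imset_f // (fintype.subsetP tC).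
move=> [vC]; rewrite -tS => /imsetP[u ut guv].
by rewrite (proper_gam CK vC _ guv) // (fintype.subsetP tC).
Qed.

Lemma sub_restr (C t : {set V}) (S : {set Gam}) :
  t \subset C -> gam @: t \subset S -> t \subset restr C S.
Proof.
move=> tC tS; apply/fintype.subsetP => v vt.
by rewrite inE (fintype.subsetP tC) // (fintype.subsetP tS) // imset_f.
Qed.

Variables (F : fieldType) (G : Type) (act : G -> V -> V).

Lemma equiv_f_flag i g :
  equiv_f F K act i g =
  \sum_(T : {set Gam} | #|T| == i) equiv_flag_f F K act gam T g.
Proof.
rewrite /equiv_f /equiv_flag_f -natr_sum; congr (_%:R).
rewrite -sum1_card (partition_big (fun s : {set V} => gam @: s)
  (fun T => #|T| == i)) /=.
  apply: eq_bigr => T /eqP Ti; rewrite -sum1_card; apply: eq_bigl => s.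
  rewrite !inE; case sK: (s \in faces K) => //=.
  have [sT|] := eqVneq (gam @: s) T; last by rewrite andbF.
  by rewrite -(card_colors sK) sT Ti eqxx /= andbT.
move=> s; rewrite inE => /and3P[sK /eqP<- _].
by rewrite card_colors.
Qed.

(** A color set [T] of size at most [k] lies in ['C(crank K - #|T|, k - #|T|)] color sets of size
    [k], since there are [crank K] colors. Exchanging the sums over [S] and [T] produces these
    binomials. *)
Lemma equiv_h_flag k g : (k <= crank K)%N ->
  equiv_h F K act k g =
  \sum_(S : {set Gam} | #|S| == k) equiv_flag_h F K act gam S g.
Proof.
move=> kcr; rewrite /equiv_h /equiv_flag_h.
rewrite (exchange_big_dep (fun T : {set Gam} => (#|T| <= k)%N)) /=; last first.
  by move=> S T /eqP <- /subset_leq_card.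
transitivity (\sum_(T : {set Gam} | (#|T| <= k)%N)
    (-1) ^+ (k - #|T|) * 'C(crank K - #|T|, k - #|T|)%:R *
    equiv_flag_f F K act gam T g).
  rewrite big_mkord; under eq_bigr do rewrite equiv_f_flag mulr_sumr.
  rewrite (exchange_big_dep (fun T : {set Gam} => (#|T| <= k)%N)) /=; last first.
    by move=> i T _ /eqP ->; rewrite -ltnS.
  apply: eq_bigr => T Tk; rewrite (big_pred1 (Ordinal (Tk : (#|T| < k.+1)%N))) //.
apply: eq_bigr => T Tk.
rewrite (eq_bigr (fun=> (-1) ^+ (k - #|T|) * equiv_flag_f F K act gam T g));
  last by move=> S /andP[/eqP ->].
rewrite sumr_const -[RHS]mulr_natr [RHS]mulrAC; congr (_ * _%:R * _).
rewrite -bal -cardsT.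
have -> : (#|[set: Gam]| - #|T|)%N = #|~: T|.
  by rewrite (cardsCs (~: T)) finset.setCK cardsT.
rewrite -cards_draws -sum1_card -[RHS]sum1_card.
(* A superset [S] of [T] is encoded by [A = S :\: T], a subset of the complement of [T]. *)
rewrite [RHS](reindex_onto (fun A => T :|: A) (fun S => S :\: T)) /=; last first.
  move=> S /andP[_ TS]; apply/setP => c; rewrite !inE.
  by case cT: (c \in T) => //=; rewrite (fintype.subsetP TS).
apply: eq_bigl => A; rewrite !inE -topredE /= finset.subsetUl andbT.
have [AT|nAT] /= := boolP (A \subset ~: T); last first.
  apply/esym/negP => /andP[_ /eqP AE]; move/negP: nAT; apply.
  by rewrite -AE finset.setDE finset.subsetIr.
have -> : (T :|: A) :\: T = A.
  rewrite finset.setDUl finset.setDv finset.set0U; apply/finset.setDidPl.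
  by rewrite finset.disjoints_subset.
have dTA : [disjoint T & A] by rewrite disjoint_sym finset.disjoints_subset.
rewrite eqxx andbT cardsU disjoint_setI0 // cards0 subn0.
by apply/eqP/eqP; lia.
Qed.

End Coloring.

(** * Shellings *)

Section Shelling.
Variables (F : fieldType) (V : finType) (K : scomplex V).
Variables (G : groupType) (act : G -> V -> V).
Hypotheses (act1 : forall v, act 1%g v = v)
  (actM : forall g h v, act (g * h)%g v = act g (act h v))
  (act_face : forall g s, s \in faces K -> act g @: s \in faces K).

Variables (Gam : finType) (gam : V -> Gam).
Hypotheses (proper_gam : proper_coloring K gam) (bal : balanced K Gam)
  (pres : preserves_coloring act gam).

(** An abstract shelling: [Rs C] is the restriction face and [len] orders the facets. [Rs_len] also
    makes the intervals from [Rs C] to [C] disjoint, because a common face of two of them would give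
    [len C < len D < len C]. *)
Variables (Rs : {set V} -> {set V}) (len : {set V} -> nat).
Hypotheses
  (Rs_ex : forall s, s \in faces K ->
     exists C, [/\ facet K C, Rs C \subset s & s \subset C])
  (Rs_len : forall C D, facet K C -> facet K D -> C != D ->
     Rs C \subset D -> (len C < len D)%N).

Let X := {C : {set V} | facet K C}.
Let M : lmodType F := {ffun X -> F^o}.

Let scaleo (a b : F) : a *: (b : F^o) = a * b. Proof. by []. Qed.

Let ind (t : {set V}) : M := [ffun D : X => (t \subset val D)%:R].

(** [Rs_ex] applied to the face [C] yields a facet containing [C]; equal cardinality forces it to be
    [C]. *)
Lemma shelling_sub C : facet K C -> Rs C \subset C.
Proof.
move=> fC; have [CK /eqP Ccr] := andP fC.
have [D [/andP[_ /eqP Dcr] RD CD]] := Rs_ex CK.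
suff CE : C = D by rewrite {1}CE.
by apply/eqP; rewrite finset.eqEcard CD Ccr Dcr /=.
Qed.

Let faces_of (S : {set Gam}) :=
  {t : {set V} | (t \in faces K) && (gam @: t == S)}.

Lemma colors_act g (t : {set V}) : gam @: (act g @: t) = gam @: t.
Proof.
by rewrite -imset_comp; apply: eq_imset => v /=; apply: pres.
Qed.

Lemma act_inj g : injective (act g).
Proof. by apply: (can_inj (g := act g^-1)) => v; rewrite -actM mulVg act1. Qed.

Lemma facet_act g C : facet K C -> facet K (act g @: C).
Proof.
case/andP=> CK Ccr; rewrite /facet act_face //= card_imset //.
exact: act_inj.
Qed.

Let mkX (C : {set V}) (fC : facet K C) : X := Sub C fC.
Let mkF S (t : {set V}) (tP : (t \in faces K) && (gam @: t == S)) : faces_of S :=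
  Sub t tP.
Let actX (g : G) (D : X) : X := mkX (facet_act g (valP D)).
(** The inverse makes this a left action, sending [ind t] to [ind (act g @: t)]. *)
Let act_fun (g : G) (phi : M) : M := [ffun D : X => phi (actX g^-1 D)].

Let act_fun_linear g : linear (act_fun g).
Proof. by move=> a u v; apply/ffunP => D; rewrite !ffunE. Qed.

Let act_fun_ind g (t : {set V}) : act_fun g (ind t) = ind (act g @: t).
Proof.
apply/ffunP => D; rewrite !ffunE /=; congr (_%:R); congr nat_of_bool.
apply/fintype.subsetP/fintype.subsetP => tD v.
  case/imsetP => u ut ->; have /imsetP[w wD ->] := tD _ ut.
  by rewrite -actM mulgV act1.
move=> vt; have /tD vD : act g v \in act g @: t by rewrite imset_f.
by apply/imsetP; exists (act g v); rewrite // -actM mulVg act1.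
Qed.

(** Triangularity: [ind (Rs C)] is 1 at [C] and vanishes at every other facet that is not longer
    than [C]. In a relation, evaluate at a shortest facet with nonzero coefficient. The map [h]
    allows subfamilies. *)
Let lin_free_Rs (J : finType) (h : J -> X) : injective h ->
  lin_free (fun j => ind (Rs (val (h j)))).
Proof.
move=> inj_h c c0 j; apply/eqP/negPn/negP => cj.
have [i ci imin] := arg_minnP (fun i => len (val (h i))) (cj : (fun j => c j != 0) j).
move/ffunP/(_ (h i)): c0; rewrite sum_ffunE (bigD1 i) //= !ffunE.
rewrite shelling_sub ?(valP (h i)) // big1 => [|k ki].
  by rewrite addr0 scaleo mulr1 => ci0; move: ci; rewrite ci0 eqxx.
rewrite !ffunE; have [Rk|] := boolP (_ \subset _); last by rewrite scaler0.
have [->|/imin] := eqVneq (c k) 0; first by rewrite scale0r.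
rewrite leqNgt Rs_len //; [exact: valP | exact: valP |].
by rewrite (inj_eq val_inj) (inj_eq inj_h).
Qed.

(** A facet contains exactly one face of color set [S], so these indicators have disjoint supports,
    nonempty by [Rs_ex]. *)
Let lin_free_faces S : lin_free (fun t : faces_of S => ind (val t)).
Proof.
move=> c c0 t; have [tK /eqP tS] := andP (valP t).
have [D [fD RD tD]] := Rs_ex tK.
move/ffunP/(_ (mkX fD)): c0; rewrite sum_ffunE (bigD1 t) //= !ffunE /= tD.
rewrite big1 => [|u ut]; first by rewrite addr0 scaleo mulr1.
rewrite !ffunE /=; have [uD|] := boolP (_ \subset _); last by rewrite scaler0.
have [uK /eqP uS] := andP (valP u).
case/eqP: ut; apply: val_inj.
by rewrite /= (restr_unique proper_gam fD uD uS) (restr_unique proper_gam fD tD tS).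
Qed.

(** When the colors of [Rs C] lie in [S], a facet contains [Rs C] exactly when its face of color set
    [S] does. *)
Let ind_faces (S : {set Gam}) (C : {set V}) : facet K C -> gam @: Rs C \subset S ->
  ind (Rs C) = \sum_(t : faces_of S) (Rs C \subset val t)%:R *: ind (val t).
Proof.
move=> fC RS; apply/ffunP => D; rewrite sum_ffunE ffunE.
have fD := valP D.
have DSP : (restr gam (val D) S \in faces K) && (gam @: restr gam (val D) S == S).
  by rewrite (restr_face _ _ fD) (colors_restr proper_gam bal _ fD) eqxx.
pose DS : faces_of S := mkF DSP.
rewrite (bigD1 DS) //= !ffunE /= restr_sub big1 ?addr0 => [|u uDS].
  rewrite scaleo mulr1; congr (_%:R); congr nat_of_bool.
  apply/idP/idP => [RD|/fintype.subset_trans]; first exact: sub_restr.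
  by apply; apply: restr_sub.
rewrite !ffunE; have [uD|] := boolP (val u \subset _); last by rewrite scaler0.
have [uK /eqP uS] := andP (valP u).
by case/eqP: uDS; apply: val_inj; rewrite /= (restr_unique proper_gam fD uD uS).
Qed.

Let Rs_of (S : {set Gam}) := {C : X | gam @: Rs (val C) \subset S}.

(** Downward induction on the length of the facet [C] with [Rs C \subset t \subset C]. Subtracting
    from [ind (Rs C)] the indicators of the other faces [u] of color set [S] above [Rs C] leaves
    [ind t], and each [u] belongs to a longer facet. *)
Let lin_comb_Rs S (t : faces_of S) :
  lin_comb (fun C : Rs_of S => ind (Rs (val (val C)))) (ind (val t)).
Proof.
pose mx := (\max_(C : {set V}) len C)%N.
have [tK _] := andP (valP t); have [C [fC RC tC]] := Rs_ex tK.
have [N] := ubnP (mx - len C); elim: N t C {tK} fC RC tC => // N IH t C fC RC tC.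
rewrite ltnS => CN; have [tK /eqP tS] := andP (valP t).
have RS : gam @: Rs C \subset S by rewrite -tS imsetS.
have -> : ind (val t) = 1 *: ind (Rs C) + (-1) *:
    \sum_(u : faces_of S) ((Rs C \subset val u) && (u != t))%:R *: ind (val u).
  rewrite scaleN1r scale1r (ind_faces fC RS) (bigD1 t) //= RC scale1r.
  rewrite [X in _ - X](bigD1 t) //= eqxx andbF scale0r add0r.
  rewrite [X in _ + X - _](eq_bigr (fun u : faces_of S =>
    ((Rs C \subset val u) && (u != t))%:R *: ind (val u))) ?addrK //.
  by move=> u ->; rewrite andbT.
apply: lin_combD; apply: lin_combZ.
  exists (fun D : Rs_of S => (val (val D) == C)%:R).
  pose CS : Rs_of S := @Sub X _ (Rs_of S) (mkX fC) RS.
  rewrite (bigD1 CS) //= eqxx scale1r big1 ?addr0 // => D.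
  by rewrite -2!(inj_eq val_inj) /= => /negbTE->; rewrite scale0r.
apply: lin_comb_sum => u.
case: (boolP (_ && _)) => [/andP[Ru ut] _|_]; last by rewrite eqxx.
have [uK /eqP uS] := andP (valP u); have [D [fD RD uD]] := Rs_ex uK.
(* If [D] were [C], then [u] and [t] would be two faces of [C] with the same color set. *)
have CD : C != D.
  apply: contraNneq ut => CD; have uC : val u \subset C by rewrite CD.
  rewrite -(inj_eq val_inj).
  by rewrite (restr_unique proper_gam fC uC uS) (restr_unique proper_gam fC tC tS).
have lCD := Rs_len fC fD CD (fintype.subset_trans Ru uD).
have : (len D <= mx)%N by apply: leq_bigmax.
move=> lD; apply: IH RD uD _ => //; by lia.
Qed.

(** The block triangularity: [act g @: Rs C] is again a face with the colors of [Rs C], so only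
    basis vectors with colors among these occur. *)
Let coef_ex g (C : X) : exists a : X -> F,
  (forall D, ~~ (gam @: Rs (val D) \subset gam @: Rs (val C)) -> a D = 0) /\
  ind (act g @: Rs (val C)) = \sum_D a D *: ind (Rs (val D)).
Proof.
set S := gam @: Rs (val C).
have tP : (act g @: Rs (val C) \in faces K) && (gam @: (act g @: Rs (val C)) == S).
  rewrite colors_act eqxx act_face //.
  have /andP[CK _] := valP C; exact: faces_sub CK (shelling_sub (valP C)).
have [c cE] := lin_comb_Rs (mkF tP).
exists (fun D => oapp c 0 (insub D)); split=> [D DS|]; first by rewrite insubN.
rewrite /= in cE; rewrite {}cE.
rewrite [RHS](bigID (fun D : X => gam @: Rs (val D) \subset S)) /=.
rewrite [X in _ = _ + X]big1 ?addr0 => [|D DS]; last by rewrite insubN // scale0r.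
rewrite [RHS](reindex_omap (val : Rs_of S -> X) insub) /= => [|D DS]; last first.
  by rewrite insubT.
by apply: eq_big => D; rewrite ?valK ?(valP D) ?eqxx.
Qed.

Lemma shelling_flag_effective (S : {set Gam}) :
  effective (equiv_flag_h F K act gam S).
Proof.
have cg g : exists b : X -> X -> F, forall C,
    (forall D, ~~ (gam @: Rs (val D) \subset gam @: Rs (val C)) -> b C D = 0) /\
    ind (act g @: Rs (val C)) = \sum_D b C D *: ind (Rs (val D)).
  by have [b bP] := choice (coef_ex g); exists b.
have [a aP] := choice cg.
(* Transposing puts images into columns, so that [A] is multiplicative in [g]. *)
pose A g i j := a g j i.
have AE g C : act_fun g (ind (Rs (val C))) = \sum_D A g D C *: ind (Rs (val D)).
  by rewrite act_fun_ind; have [_ ->] := aP g C.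
have A0 g C D : ~~ (gam @: Rs (val D) \subset gam @: Rs (val C)) -> A g D C = 0.
  by have [+ _] := aP g C; apply.
have freeX : lin_free (fun C : X => ind (Rs (val C))) by apply: lin_free_Rs.
have A1 i j : A 1%g i j = (i == j)%:R.
  apply: (lin_free_eq (c := fun i => A 1%g i j) (c' := fun i => (i == j)%:R) freeX).
  rewrite -AE [RHS](bigD1 j) //= eqxx scale1r big1 ?addr0 => [|k /negbTE->];
    last by rewrite scale0r.
  rewrite act_fun_ind; congr ind; rewrite -[RHS]imset_id.
  by apply: eq_imset => v; rewrite act1.
have AM g h i j : A (g * h)%g i j = \sum_k A g i k * A h k j.
  apply: (lin_free_eq (c := fun i => A (g * h)%g i j)
     (c' := fun i => \sum_k A g i k * A h k j) freeX).
  rewrite -AE (_ : act_fun (g * h)%g _ = act_fun g (act_fun h (ind (Rs (val j))))); last first.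
    rewrite !act_fun_ind -imset_comp; congr ind.
    by apply: eq_imset => v; rewrite /= actM.
  rewrite AE linear_sumZ; last exact: act_fun_linear.
  under eq_bigr do rewrite AE scaler_sumr.
  rewrite exchange_big; apply: eq_bigr => k _; rewrite scaler_suml.
  by apply: eq_bigr => l _; rewrite scalerA mulrC.
(* The trace of [g] on the functions that depend only on the face of color set [T], in two bases:
   indicators of faces are permuted, which counts fixed faces; the restriction faces give diagonal
   entries of [A]. *)
have flag_fE T g : equiv_flag_f F K act gam T g =
    \sum_(C : X | gam @: Rs (val C) \subset T) A g C C.
  transitivity (\sum_(t : faces_of T) (act g @: val t == val t)%:R : F).
    rewrite -natr_sum -big_mkcond /=; congr (_%:R).
    rewrite /equiv_flag_f -sum1_card.
    rewrite (reindex_omap (val : faces_of T -> _) insub) /=; last first.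
      by move=> t; rewrite inE => /and3P[tK tT _]; rewrite insubT ?tK.
    apply: eq_bigl => t; rewrite valK eqxx andbT inE.
    by have /andP[-> ->] := valP t.
  transitivity (\sum_(C : Rs_of T) A g (val C) (val C)); last first.
    rewrite [RHS](reindex_omap (val : Rs_of T -> X) insub) /= => [|D DS]; last first.
      by rewrite insubT.
    by apply: eq_bigl => D; rewrite ?valK ?(valP D) ?eqxx.
  have faceE (t : faces_of T) : act_fun g (ind (val t)) =
      \sum_(u : faces_of T) (val u == act g @: val t)%:R *: ind (val u).
    have [tK tT] := andP (valP t).
    have gtP : (act g @: val t \in faces K) && (gam @: (act g @: val t) == T).
      by rewrite colors_act tT act_face.
    rewrite act_fun_ind (bigD1 (mkF gtP)) //= eqxx scale1r big1 ?addr0 // => u.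
    by rewrite -(inj_eq val_inj) /= => /negbTE->; rewrite scale0r.
  transitivity (\sum_(t : faces_of T) (val t == act g @: val t)%:R : F).
    by apply: eq_bigr => t _; rewrite eq_sym.
  symmetry; apply: (@trace_basis_change _ _ (act_fun g) _ _
    (fun C : Rs_of T => ind (Rs (val (val C)))) (fun t : faces_of T => ind (val t))
    (fun D C => A g (val D) (val C)) (fun u t => (val u == act g @: val t)%:R)) => //.
  - exact: lin_free_Rs (val_inj).
  - move=> C; exists (fun t : faces_of T => (Rs (val (val C)) \subset val t)%:R).
    by apply: ind_faces; [exact: (valP (val C)) | exact: (valP C)].
  - move=> C; rewrite AE.
    rewrite (bigID (fun D : X => gam @: Rs (val D) \subset T)) /=.
    rewrite [X in _ + X = _]big1 ?addr0 => [|D DT]; last first.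
      rewrite A0 ?scale0r //; apply: contra DT => /fintype.subset_trans; apply.
      exact: (valP C).
    rewrite [LHS](reindex_omap (val : Rs_of T -> X) insub) /= => [|D DS]; last first.
      by rewrite insubT.
    by apply: eq_bigl => D; rewrite ?valK ?(valP D) ?eqxx.
pose I := {C : X | gam @: Rs (val C) == S}.
have -> : equiv_flag_h F K act gam S = fun g => \sum_(C : I) A g (val C) (val C).
  apply/funext => g; rewrite /equiv_flag_h.
  under eq_bigr do rewrite flag_fE mulr_sumr.
  rewrite (exchange_big_dep (fun C : X => gam @: Rs (val C) \subset S)) /=; last first.
    by move=> T C TS CT; apply: fintype.subset_trans CT TS.
  transitivity (\sum_(C : X | gam @: Rs (val C) \subset S)
      (gam @: Rs (val C) == S)%:R * A g C C).
    (* Moebius inversion: the signs over all [T] between the colors of [Rs C] and [S] cancel unless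
       these are equal. *)
    apply: eq_bigr => C CS; rewrite -mulr_suml -(sum_interval_sign F CS).
    by congr (_ * _); apply: eq_bigl => T; rewrite andbC.
  rewrite (bigID (fun C : X => gam @: Rs (val C) == S)) /=.
  rewrite [X in _ + X = _]big1 ?addr0 => [|C /andP[_ /negbTE ->]]; last by rewrite mul0r.
  rewrite (reindex_omap (val : I -> X) insub) /= => [|C /andP[_ CS]]; last first.
    by rewrite insubT.
  apply: eq_big => C; rewrite valK eqxx ?andbT ?(valP C) ?mul1r ?andbT //.
  by rewrite (eqP (valP C)) fintype.subxx.
apply: (@effective_trace_fin _ _ I (fun g i j => A g (val i) (val j))).
  by move=> i j; rewrite A1 (inj_eq val_inj).
(* An intermediate [C] contributes only if its colors lie between those of [i] and [j]; both are
   [S], so the diagonal block is itself multiplicative. *)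
move=> g h i j; rewrite AM.
rewrite (bigID (fun C : X => gam @: Rs (val C) == S)) /=.
rewrite [X in _ + X = _]big1 ?addr0 => [|C CS]; last first.
  have [iC|/A0->] := boolP (gam @: Rs (val (val i)) \subset gam @: Rs (val C));
    last by rewrite mul0r.
  have [Cj|/A0->] := boolP (gam @: Rs (val C) \subset gam @: Rs (val (val j)));
    last by rewrite mulr0.
  case/negP: CS; rewrite finset.eqEsubset.
  by rewrite -{1}(eqP (valP j)) Cj -(eqP (valP i)) iC.
rewrite (reindex_omap (val : I -> X) insub) /= => [|C CS]; last by rewrite insubT.
by apply: eq_bigl => C; rewrite valK eqxx (valP C).
Qed.

End Shelling.

(** * Hilbert series of Stanley-Reisner rings *)

Section HilbertSeries.
Variables (F : fieldType) (V : finType) (K : scomplex V).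
Local Notation n := #|V|.

Definition msupport (m : 'X_{1..n}) : {set V} :=
  [set v | m (enum_rank v) != 0%N]%SET.

(** Bounding the degree makes this a finite type, which can index a basis. *)
Definition face_monomial (k : nat) :=
  {m : 'X_{1..n < k.+1} | (mdeg m == k) && (msupport m \in faces K)}.

Lemma sr_pi_eq0 (p : {mpoly F[n]}) :
  (sr_pi K p == 0) = (p \in @sr_ideal F V K).
Proof.
rewrite -(rmorph0 (@sr_pi F V K)) -[p in RHS]subr0.
by rewrite /sr_pi Quotient.idealrBE.
Qed.

Lemma sr_piZ (c : F) (p : {mpoly F[n]}) : sr_pi K (c *: p) = c *: sr_pi K p.
Proof. by rewrite -mul_mpolyC rmorphM. Qed.

Lemma sr_repr (q : sr_ring F K) : sr_pi K (generic_quotient.repr q) = q.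
Proof. exact: generic_quotient.reprK. Qed.

Definition set_monomial (s : {set V}) : 'X_{1..n} :=
  [multinom (enum_val i \in s : nat) | i < n].

Lemma prod_vvar (s : {set V}) :
  \prod_(v in s) vvar F v = 'X_[set_monomial s].
Proof.
rewrite mpolyXE_id [RHS](reindex_onto enum_rank enum_val) /=; last first.
  by move=> i _; rewrite enum_valK.
rewrite big_mkcond; apply: eq_big => v; first by rewrite enum_rankK eqxx.
by rewrite mnmE enum_rankK /vvar; case: (v \in s).
Qed.

(** Every monomial of a multiple of the generator of a non-face [s] has support containing [s],
    hence is not supported on a face. *)
Lemma sr_ideal_coef (p : {mpoly F[n]}) (m : 'X_{1..n}) :
  p \in @sr_ideal F V K -> msupport m \in faces K -> p@_m = 0.
Proof.
move=> /asboolP[q ->] mK; rewrite raddf_sum big1 //= => s sK.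
rewrite prod_vvar; apply: memN_msupp_eq0; rewrite (perm_mem (msuppMX _ _)).
apply/mapP => -[m' _ mE]; case/negP: sK; apply: faces_sub mK _.
by apply/fintype.subsetP => v vs; rewrite inE mE mnmDE mnmE enum_rankK vs.
Qed.

Lemma sr_ideal_monomial (m : 'X_{1..n}) :
  msupport m \notin faces K -> 'X_[m] \in @sr_ideal F V K.
Proof.
move=> mK; apply/asboolP.
exists (fun s => if s == msupport m then 'X_[m - set_monomial s] else 0).
rewrite (bigD1 (msupport m)) //= eqxx [X in _ + X]big1 ?addr0 => [|s]; last first.
  by case/andP => _ /negbTE->; rewrite mul0r.
rewrite prod_vvar -mpolyXD submK //; apply/mnm_lepP => i.
by rewrite mnmE inE enum_valK; case: (m i).
Qed.

Lemma sr_monomial_free k :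
  lin_free (fun m : face_monomial k => sr_pi K 'X_[val m] : sr_ring F K).
Proof.
move=> c; under eq_bigr do rewrite -sr_piZ.
rewrite -raddf_sum => /eqP; rewrite sr_pi_eq0 => cI m.
have [_ mK] := andP (valP m).
have := sr_ideal_coef cI mK; rewrite raddf_sum (bigD1 m) //= big1 => [|u um].
  by rewrite addr0 mcoeffZ mcoeffX eqxx mulr1.
rewrite mcoeffZ mcoeffX (_ : (_ == _) = false) ?mulr0 //.
by apply/negbTE; rewrite -bmeqP (inj_eq val_inj).
Qed.

Lemma sr_monomial_span k (w : sr_ring F K) : sr_graded k w ->
  lin_comb (fun m : face_monomial k => sr_pi K 'X_[val m] : sr_ring F K) w.
Proof.
move=> [p /= /dhomogP pk <-]; rewrite [p in sr_pi _ p]mpolyE raddf_sum /= big_seq.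
elim/big_rec: _ => [|m q mp].
  by exists (fun=> 0); rewrite big1 // => i _; rewrite scale0r.
apply: lin_combD; rewrite sr_piZ; apply: lin_combZ.
have mk := pk _ mp.
have [mK|mK] := boolP (msupport m \in faces K); last first.
  exists (fun=> 0); rewrite big1 => [|i _]; last by rewrite scale0r.
  by apply/eqP; rewrite sr_pi_eq0 sr_ideal_monomial.
have mk1 : (mdeg m < k.+1)%N by rewrite -[mdeg m]/(mdeg m) mk.
have mP : (mdeg (BMultinom mk1) == k) && (msupport (BMultinom mk1) \in faces K).
  by rewrite /= mK andbT; apply/eqP.
exists (fun u => (u == (Sub (BMultinom mk1) mP : face_monomial k))%:R).
rewrite (bigD1 (Sub (BMultinom mk1) mP : face_monomial k)) //= eqxx scale1r.
by rewrite big1 ?addr0 // => u /negbTE->; rewrite scale0r.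
Qed.

Variables (f : V -> V) (inj_f : injective f).
Hypothesis f_face : forall s : {set V}, (f @: s \in faces K) = (s \in faces K).

(** The exponent of [v] moves to [f v], hence the inverse of [f] in the formula. *)
Definition monomial_act (m : 'X_{1..n}) : 'X_{1..n} :=
  [multinom m (enum_rank (invF inj_f (enum_val i))) | i < n].

Lemma monomial_actE m v :
  monomial_act m (enum_rank (f v)) = m (enum_rank v).
Proof. by rewrite mnmE enum_rankK invF_f. Qed.

Lemma vpoly_act_monomial m : vpoly_act f 'X_[m] = 'X_[F, monomial_act m].
Proof.
rewrite /vpoly_act comp_mpolyX mpolyXE_id.
rewrite [RHS](reindex_onto (fun i => enum_rank (f (enum_val i)))
  (fun i => enum_rank (invF inj_f (enum_val i)))) /=; last first.
  by move=> i _; rewrite enum_rankK f_invF enum_valK.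
apply: eq_big => i; first by rewrite enum_rankK invF_f enum_valK eqxx.
by move=> _; rewrite tnth_mktuple monomial_actE enum_valK.
Qed.

Lemma monomial_act_support m : msupport (monomial_act m) = f @: msupport m.
Proof.
apply/setP => v; rewrite inE; apply/idP/imsetP => [mv|[u + ->]].
  exists (invF inj_f v); last by rewrite f_invF.
  by rewrite inE -(monomial_actE m) f_invF.
by rewrite inE monomial_actE.
Qed.

Lemma monomial_act_deg m : mdeg (monomial_act m) = mdeg m.
Proof.
rewrite !mdegE [LHS](reindex_onto (fun i => enum_rank (f (enum_val i)))
  (fun i => enum_rank (invF inj_f (enum_val i)))) /=; last first.
  by move=> i _; rewrite enum_rankK f_invF enum_valK.
apply: eq_big => i; first by rewrite enum_rankK invF_f enum_valK eqxx.
by move=> _; rewrite monomial_actE enum_valK.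
Qed.

Lemma vpoly_act_set (s : {set V}) :
  vpoly_act f (\prod_(v in s) vvar F v) = \prod_(v in f @: s) vvar F v.
Proof.
rewrite big_imset /= => [|u v _ _]; last exact: inj_f.
rewrite /vpoly_act rmorph_prod; apply: eq_bigr => v _.
by rewrite /= comp_mpolyXU -tnth_nth tnth_mktuple enum_rankK.
Qed.

(** The generator of [s] is sent to the generator of [f @: s], and [f] permutes the non-faces. *)
Lemma vpoly_act_ideal (p : {mpoly F[n]}) :
  p \in @sr_ideal F V K -> vpoly_act f p \in @sr_ideal F V K.
Proof.
move=> /asboolP[q ->]; apply/asboolP.
exists (fun s : {set V} => vpoly_act f (q (f @^-1: s)%SET)).
rewrite /vpoly_act raddf_sum.
rewrite [RHS](reindex_onto (fun s : {set V} => f @: s) (fun s : {set V} => f @^-1: s)%SET) /=;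
  last first.
  move=> s _; apply/setP => v; apply/imsetP/idP => [[u + ->]|vs].
    by rewrite inE.
  by exists (invF inj_f v); rewrite ?inE f_invF.
have fK (s : {set V}) : (f @^-1: (f @: s))%SET = s.
  by apply/setP => v; rewrite inE mem_imset.
apply: eq_big => s; first by rewrite f_face fK eqxx andbT.
by move=> _; rewrite fK rmorphM /= -/(vpoly_act f (\prod_(v in s) _)) vpoly_act_set.
Qed.

Lemma sr_act_pi (p : {mpoly F[n]}) :
  sr_act f (sr_pi K p) = sr_pi K (vpoly_act f p).
Proof.
rewrite /sr_act; apply/eqP; rewrite -subr_eq0 -raddfB sr_pi_eq0 /vpoly_act -raddfB.
by apply: vpoly_act_ideal; rewrite -sr_pi_eq0 raddfB /= sr_repr subrr.
Qed.

Lemma sr_act_linear : linear (@sr_act F V K f).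
Proof.
move=> a u v; rewrite -(sr_repr u) -(sr_repr v) -sr_piZ -raddfD !sr_act_pi.
by rewrite -sr_piZ -raddfD /vpoly_act linearP.
Qed.

(** The automorphism permutes the monomial basis, so its trace counts fixed monomials. *)
Lemma trace_sr_act k :
  trace_on (@sr_graded F V K k) (sr_act f) =
  (#|[set m : face_monomial k | monomial_act (val m) == val m :> 'X_{1..n}]%SET|)%:R.
Proof.
rewrite (trace_onE (A := fun u m : face_monomial k =>
    (val u == monomial_act (val m) :> 'X_{1..n})%:R) sr_act_linear _ _
    (@sr_monomial_free k)).
- rewrite -natr_sum -big_mkcond /=; congr (_%:R); rewrite -[RHS]sum1_card.
  by apply: eq_bigl => m; rewrite inE eq_sym.
- move=> m; exists 'X_[val m] => //=; rewrite dhomogX.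
  by have [] := andP (valP m).
- exact: sr_monomial_span.
- move=> m; rewrite sr_act_pi vpoly_act_monomial.
  have [/eqP mk mK] := andP (valP m).
  have mk1 : (mdeg (monomial_act (val m)) < k.+1)%N by rewrite monomial_act_deg mk.
  have mP : (mdeg (BMultinom mk1) == k) && (msupport (BMultinom mk1) \in faces K).
    by rewrite /= monomial_act_deg mk eqxx monomial_act_support f_face.
  rewrite (bigD1 (Sub (BMultinom mk1) mP : face_monomial k)) //= eqxx scale1r.
  rewrite big1 ?addr0 // => u; rewrite -(inj_eq val_inj) bmeqP /= => /negbTE->.
  by rewrite scale0r.
Qed.

End HilbertSeries.

(** * Alcoves *)

(** Finitely many strict inequalities survive a small perturbation. It serves both for topological
    neighborhoods and for moving points between alcoves. *)
Lemma small_step (R : realFieldType) (I : finType) (a b c : I -> R) :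
  (forall i, a i < c i) ->
  exists e, [/\ 0 < e, e < 1 & forall i, a i + e * b i < c i].
Proof.
move=> ac; pose r i := (1 + `|b i|) / (c i - a i).
have r_gt0 i : 0 < r i.
  by rewrite divr_gt0 ?subr_gt0 //; have := normr_ge0 (b i); lra.
have S_ge0 : 0 <= \sum_i r i by apply: sumr_ge0 => i _; apply/ltW.
(* The sum bounds every [r i] at once, so [e * r i < 1]; the 2 gives [e < 1] even for an empty index
   type. *)
pose e := (2 + \sum_i r i)^-1.
have e_gt0 : 0 < e by rewrite invr_gt0; lra.
exists e; split=> // [|i]; first by rewrite invf_lt1; lra.
have ler1 : e * r i < 1.
  rewrite mulrC ltr_pdivrMr; last by lra.
  rewrite mul1r (bigD1 i) //=.
  have : 0 <= \sum_(j | j != i) r j by apply: sumr_ge0 => j _; apply/ltW.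
  lra.
have : e * (1 + `|b i|) < c i - a i.
  by move: ler1; rewrite mulrA ltr_pdivrMr ?subr_gt0 ?mul1r.
have := ler_norm (b i); nra.
Qed.

Section Alcoves.
Variables (R : realType) (d : nat).
Local Notation I := (option 'I_d).
Implicit Types (x y z : 'rV[R]_d) (i j : I).
Local Open Scope classical_set_scope.

(* Adding a coordinate [x_None = 0] makes the hyperplanes [x_i = k] instances
   of [x_i - x_j = k]. *)
Definition hcoord x i : R := oapp (x ord0) 0 i.
Definition hdiff x i j : R := hcoord x i - hcoord x j.
Definition generic x : Prop := forall i j, i != j -> hdiff x i j \isn't a Num.int.
Definition hfloor x i j : int := Num.floor (hdiff x i j).
Definition open_alcove x : set 'rV[R]_d :=
  [set y | forall i j, i != j ->
     (hfloor x i j)%:~R < hdiff y i j < (hfloor x i j)%:~R + 1].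
Definition alcove x : set 'rV[R]_d :=
  [set y | forall i j,
     (hfloor x i j)%:~R <= hdiff y i j <= (hfloor x i j)%:~R + 1].

Lemma hdiffxx x i : hdiff x i i = 0. Proof. exact: subrr. Qed.

Lemma hfloorxx x i : hfloor x i i = 0.
Proof. by rewrite /hfloor hdiffxx floor0. Qed.

Lemma hdiffC x i j : hdiff x i j = - hdiff x j i.
Proof. by rewrite opprB. Qed.

Lemma hdiffD x i j k : hdiff x i k = hdiff x i j + hdiff x j k.
Proof. by rewrite addrA subrK. Qed.

Lemma hcoord_lin (a b : R) x y i :
  hcoord (a *: x + b *: y) i = a * hcoord x i + b * hcoord y i.
Proof. by case: i => [i|] /=; rewrite ?mxE ?mulr0 ?addr0. Qed.

Lemma hdiff_lin (a b : R) x y i j :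
  hdiff (a *: x + b *: y) i j = a * hdiff x i j + b * hdiff y i j.
Proof. by rewrite /hdiff !hcoord_lin; ring. Qed.

Lemma complement_generic x : arrangement_complement x <-> generic x.
Proof.
split=> [xA|gx].
  have xA' (i : 'I_d) (k : int) : x ord0 i <> k%:~R.
    move=> xE; apply: xA; exists [set y : 'rV[R]_d | y ord0 i = k%:~R] => //.
    by right; exists i, k.
  have xAA' (i j : 'I_d) (k : int) : (i < j)%N -> x ord0 i - x ord0 j <> k%:~R.
    move=> ij xE; apply: xA.
    exists [set y : 'rV[R]_d | y ord0 i - y ord0 j = k%:~R] => //.
    by left; exists i, j, k.
  move=> [i|] [j|] //= ij; apply/negP => /intrP[k]; rewrite /hdiff /=.
  - have : (i != j :> nat) by apply: contraNneq ij => /val_inj ->.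
    rewrite neq_ltn => /orP[lt_ij|lt_ji] E; first exact: xAA' lt_ij E.
    by apply: (xAA' _ _ (- k) lt_ji); rewrite mulrNz -E opprB.
  - by rewrite subr0 => /xA'.
  - by rewrite sub0r => E; apply: (xA' j (- k)); rewrite mulrNz -E opprK.
move=> [H [[i [j [k [ij ->]]]]|[i [k ->]]] /= E].
  have ij' : Some i != Some j by apply: contraTneq ij => -[->]; rewrite ltnn.
  by have /negP[] := gx _ _ ij'; apply/intrP; exists k.
have /negP[] := gx (Some i) None isT.
by apply/intrP; exists k; rewrite /hdiff /= subr0.
Qed.

Lemma hfloor_itv x i j : (hfloor x i j)%:~R <= hdiff x i j < (hfloor x i j)%:~R + 1.
Proof. by have := floor_itv (hdiff x i j); rewrite intrD. Qed.

Lemma generic_itv x i j : generic x -> i != j ->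
  (hfloor x i j)%:~R < hdiff x i j < (hfloor x i j)%:~R + 1.
Proof.
move=> gx ij; have /andP[xl ->] := hfloor_itv x i j; rewrite andbT lt_neqAle xl andbT.
by apply: contraNneq (gx _ _ ij) => <-; rewrite intr_int.
Qed.

Lemma open_alcove_refl x : generic x -> open_alcove x x.
Proof. by move=> gx i j; apply: generic_itv. Qed.

Lemma itv_not_int (k : int) (t : R) : k%:~R < t < k%:~R + 1 -> t \isn't a Num.int.
Proof.
move=> /andP[kt tk]; apply/negP => /intrP[n tE]; move: kt tk; rewrite tE.
by rewrite -(intrD _ k 1) !ltr_int; lia.
Qed.

Lemma open_alcove_generic x y : open_alcove x y -> generic y.
Proof. by move=> xy i j /xy; apply: itv_not_int. Qed.

Lemma hfloor_eq x y : open_alcove x y -> forall i j, hfloor y i j = hfloor x i j.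
Proof.
move=> xy i j; have [->|ij] := eqVneq i j; first by rewrite !hfloorxx.
by apply: floor_def; rewrite intrD; have /andP[/ltW-> ->] := xy _ _ ij.
Qed.

Lemma alcove_eq x y : (forall i j, hfloor y i j = hfloor x i j) -> alcove y = alcove x.
Proof.
by move=> E; apply/seteqP; split=> z xz i j; have := xz i j; rewrite E.
Qed.

Lemma alcove_generic x y : alcove x y -> generic y -> open_alcove x y.
Proof.
move=> xy gy i j ij; have /andP[l u] := xy i j; have nint := gy _ _ ij.
rewrite !lt_neqAle l u !andbT; apply/andP; split.
  by apply: contraNneq nint => <-; rewrite intr_int.
by apply: contraNneq nint => ->; rewrite -(intrD _ _ 1) intr_int.
Qed.

Lemma hfloorN x i j : generic x -> i != j -> hfloor x j i = -1 - hfloor x i j.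
Proof.
move=> gx ij; have /andP[l u] := generic_itv gx ij.
by apply: floor_def; rewrite hdiffC !intrD mulrNz; lra.
Qed.

Lemma open_alcove_segment x y z (a b : R) : 0 < a -> 0 <= b -> a + b = 1 ->
  open_alcove x y -> alcove x z -> open_alcove x (a *: y + b *: z).
Proof.
move=> a0 b0 ab xy xz i j ij; rewrite hdiff_lin.
by have /andP[? ?] := xy i j ij; have /andP[? ?] := xz i j; nra.
Qed.

Lemma open_alcove_sub x : open_alcove x `<=` alcove x.
Proof.
move=> y xy i j; have [->|ij] := eqVneq i j; first by rewrite hfloorxx hdiffxx; lra.
by have /andP[/ltW-> /ltW->] := xy _ _ ij.
Qed.

Lemma hdiff_continuous i j : continuous (fun x => hdiff x i j).
Proof.
have hc k : forall x y e, ball x e y -> 0 < e -> `|hcoord x k - hcoord y k| < e.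
  case: k => [k|] x y e /=; last by rewrite subrr normr0.
  by case=> _ /(_ ord0 k).
move=> x A /nbhs_ballP[e /= e0 eA]; apply/nbhs_ballP; exists (e / 2) => /=.
  by rewrite divr_gt0.
move=> y xy; apply: eA; rewrite /ball /=.
have := hc i _ _ _ xy; have := hc j _ _ _ xy.
rewrite divr_gt0 // => /(_ isT) h1 /(_ isT) h2.
rewrite (_ : _ - _ = (hcoord x i - hcoord y i) - (hcoord x j - hcoord y j)); last first.
  by rewrite /hdiff; ring.
by apply: le_lt_trans (ler_normB _ _) _; lra.
Qed.

Lemma segment_continuous x y : continuous (fun t : R => (1 - t) *: x + t *: y).
Proof.
move=> t A /nbhs_ballP[e /= e0 eA]; apply/nbhs_ballP.
have [s [s0 _ sP]] := small_step (I := 'I_d) (a := fun=> 0)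
  (fun k => `|y ord0 k - x ord0 k|) (c := fun=> e) (fun=> e0).
exists s => //= u tu; apply: eA; split=> // k l; rewrite !ord1.
rewrite /ball /= !mxE.
rewrite (_ : _ - _ = (t - u) * (y ord0 l - x ord0 l)); last by ring.
rewrite normrM; have := sP l; rewrite add0r; apply: le_lt_trans.
by apply: ler_wpM2r => //; apply/ltW.
Qed.

(** A connected set in the complement has interval images under each [hdiff], and these avoid the
    integers. Conversely the open alcove is convex, so segments connect its points to [x]. *)
Lemma connected_open_alcove x : generic x -> 
  connected_component (@arrangement_complement R d) x = open_alcove x.
Proof.
move=> gx; apply/seteqP; split=> [y [B [Bx BA cB] By] i j ij|y xy].
  have /normed_module.connected_intervalP imB :
      connected [set hdiff z i j | z in B].
    apply: connected_continuous_connected => //.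
    exact/continuous_subspaceT/hdiff_continuous.
  have not_int (k : int) : ~ [set hdiff z i j | z in B] k%:~R.
    move=> [z Bz zE]; have /complement_generic/(_ i j ij) := BA _ Bz.
    by rewrite zE intr_int.
  have /andP[l u] := generic_itv gx ij.
  have imx : [set hdiff z i j | z in B] (hdiff x i j) by exists x.
  have imy : [set hdiff z i j | z in B] (hdiff y i j) by exists y.
  apply/andP; split; rewrite ltNge; apply/negP => h.
    by apply: (not_int (hfloor x i j)); apply: (imB _ _ imy imx); rewrite h ltW.
  apply: (not_int (hfloor x i j + 1)); apply: (imB _ _ imx imy).
  by rewrite intrD h ltW.
pose S := [set (1 - t) *: x + t *: y | t in [set` `[0, 1]%R]].
exists S; last by exists 1; rewrite ?subrr ?scale0r ?scale1r ?add0r //= in_itv /= ler01 lexx.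
split.
- by exists 0; rewrite ?subr0 ?scale0r ?scale1r ?addr0 //= in_itv /= ler01 lexx.
- move=> z [t /=]; rewrite in_itv /= => /andP[t0 t1] <-; apply/complement_generic.
  have [->|tn1] := eqVneq t 1.
    by rewrite subrr scale0r add0r scale1r; apply: open_alcove_generic xy.
  apply: (@open_alcove_generic x); apply: open_alcove_segment => //.
  + by rewrite subr_gt0 lt_neqAle tn1.
  + by rewrite subrK.
  + exact: open_alcove_refl.
  + exact: open_alcove_sub.
- apply: connected_continuous_connected; first exact: normed_module.segment_connected.
  exact/continuous_subspaceT/segment_continuous.
Qed.

Lemma chambersP C : chambers C <-> exists2 x, generic x & C = open_alcove x.
Proof.
split=> [[x /complement_generic gx ->]|[x gx ->]]; exists x => //.
- exact: connected_open_alcove.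
- exact/complement_generic.
- by rewrite connected_open_alcove.
Qed.

(** The weak inequalities are closed conditions; conversely, moving a point of the alcove slightly
    towards [x] enters the open alcove. *)
Lemma closure_open_alcove x : generic x -> closure (open_alcove x) = alcove x.
Proof.
move=> gx; apply/seteqP; split=> [y cy i j|y xy A /nbhs_ballP[e /= e0 eA]].
  rewrite leNgt [X in _ && X]leNgt; apply/andP; split; apply/negP => h.
    have /cy[z [xz]] : nbhs y [set z | hdiff z i j < (hfloor x i j)%:~R].
      apply: (@hdiff_continuous i j y [set t | t < (hfloor x i j)%:~R]).
      apply/nbhs_ballP.
      exists ((hfloor x i j)%:~R - hdiff y i j) => /=; first by rewrite subr_gt0.
      by move=> t; rewrite /ball /= ltr_norml => /andP[? ?]; lra.
    by have /andP[+ _] := open_alcove_sub xz i j; rewrite /= => ? ?; lra.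
  have /cy[z [xz]] : nbhs y [set z | (hfloor x i j)%:~R + 1 < hdiff z i j].
    apply: (@hdiff_continuous i j y [set t | (hfloor x i j)%:~R + 1 < t]).
    apply/nbhs_ballP.
    exists (hdiff y i j - ((hfloor x i j)%:~R + 1)) => /=; first by rewrite subr_gt0.
    by move=> t; rewrite /ball /= ltr_norml => /andP[? ?]; lra.
  by have /andP[_ +] := open_alcove_sub xz i j; rewrite /= => ? ?; lra.
have [s [s0 s1 sP]] := small_step (I := 'I_d) (a := fun=> 0)
  (fun k => `|y ord0 k - x ord0 k|) (c := fun=> e) (fun=> e0).
exists (s *: x + (1 - s) *: y); split.
  apply: open_alcove_segment => //; [lra | lra | exact: open_alcove_refl].
apply: eA; split=> // k l; rewrite !ord1 /ball /= !mxE.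
rewrite (_ : _ - _ = s * (y ord0 l - x ord0 l)); last by ring.
by rewrite normrM gtr0_norm //; have := sP l; rewrite add0r.
Qed.

Definition map_coord (g : R -> R) x : 'rV[R]_d := \row_k g (x ord0 k).

Lemma hcoord_map (g : R -> R) x i :
  g 0 = 0 -> hcoord (map_coord g x) i = g (hcoord x i).
Proof. by move=> g0; case: i => [i|] /=; rewrite ?mxE. Qed.

(** Monotonicity and compatibility with integer translations carry each inequality between two
    coordinates over to their images; [g 0 = 0] accounts for the extra coordinate. *)
Lemma alcove_map (g : R -> R) x y :
  {homo g : a b / a <= b} -> (forall a (n : int), g (a + n%:~R) = g a + n%:~R) ->
  g 0 = 0 -> alcove x y -> alcove x (map_coord g y).
Proof.
move=> gh gD g0 xy i j; rewrite /hdiff !hcoord_map //.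
have /andP[l u] := xy i j; rewrite /hdiff in l u.
have : g (hcoord y j + (hfloor x i j)%:~R) <= g (hcoord y i) by apply: gh; lra.
have : g (hcoord y i) <= g (hcoord y j + (hfloor x i j + 1)%:~R).
  by apply: gh; rewrite intrD; lra.
by rewrite !gD intrD => ? ?; apply/andP; split; lra.
Qed.

Lemma lattice_hcoord y i : lattice_point y -> hcoord y i \is a Num.int.
Proof. by move=> ly; case: i => [i|] /=. Qed.

Let lo (t : R) : R := (Num.floor t)%:~R + Num.min 1 (2 * (t - (Num.floor t)%:~R)).
Let hi (t : R) : R := (Num.floor t)%:~R + Num.max 0 (2 * (t - (Num.floor t)%:~R) - 1).

(* A point of a closed alcove is the midpoint of its images under the two
   monotone maps [lo] and [hi], which commute with integer translations; these
   images differ unless the point is integral. *)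
Lemma extreme_alcove x y :
  extreme_point (alcove x) y <-> alcove x y /\ lattice_point y.
Proof.
split=> [[xy ext]|[xy ly]]; split=> //.
  have floorb (t : R) : (Num.floor t)%:~R <= t < (Num.floor t)%:~R + 1.
    by have := floor_itv t; rewrite intrD.
  have floorD (t : R) (n : int) : Num.floor (t + n%:~R) = Num.floor t + n.
    by rewrite floorDrz ?intr_int // intrKfloor.
  have gD g : g = lo \/ g = hi ->
      forall (a : R) (n : int), g (a + n%:~R) = g a + n%:~R.
    have E (a : R) (n : int) : a + n%:~R - (Num.floor (a + n%:~R))%:~R = a - (Num.floor a)%:~R.
      by rewrite floorD intrD; ring.
    by move=> [->|->] a n; rewrite /lo /hi E floorD intrD addrAC.
  have gh g : g = lo \/ g = hi -> {homo g : a b / a <= b}.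
    move=> gE a b ab; have := le_floor ab; rewrite le_eqVlt => /orP[/eqP fab|].
      by case: gE => ->; rewrite /lo /hi fab lerD2l ?ge_min ?le_min ?ge_max ?le_max; lra.
    rewrite -lezD1 -(ler_int R) intrD => fab.
    have /andP[? ?] := floorb a; have /andP[? ?] := floorb b.
    have ga : g a <= (Num.floor a)%:~R + 1.
      by case: gE => ->; rewrite /lo /hi lerD2l ?ge_min ?ge_max; lra.
    have gb : (Num.floor b)%:~R <= g b.
      by case: gE => ->; rewrite /lo /hi lerDl ?le_min ?le_max; lra.
    lra.
  have g0 g : g = lo \/ g = hi -> g 0 = 0.
    case=> ->; rewrite /lo /hi floor0 subrr mulr0 add0r ?sub0r.
      by apply/min_idPr; lra.
    by apply/max_idPl; lra.
  have sumE (t : R) : lo t + hi t = 2 * t.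
    rewrite /lo /hi; have /andP[? ?] := floorb t.
    by rewrite minElt maxElt; case: ifP; case: ifP; lra.
  have eqi (t : R) : lo t = hi t -> t \is a Num.int.
    move=> E; suff -> : t = (Num.floor t)%:~R by rewrite intr_int.
    move: E; rewrite /lo /hi; have /andP[? ?] := floorb t.
    by rewrite minElt maxElt; case: ifP; case: ifP; lra.
  have [lA hA] : alcove x (map_coord lo y) /\ alcove x (map_coord hi y).
    by split; apply: alcove_map; by [apply: gh; auto | apply: gD; auto | apply: g0; auto|].
  have E : map_coord lo y = map_coord hi y.
    apply: (ext _ _ (2^-1) lA hA); first by lra.
    by apply/rowP => l; rewrite !mxE; have := sumE (y ord0 l); lra.
  by move=> k; apply: eqi; have /rowP/(_ k) := E; rewrite !mxE.
move=> a b t xa xb t01 yE; apply/rowP => k.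
have := xa (Some k) None; have := xb (Some k) None; have := xy (Some k) None.
have /intrP[n yk] := ly k.
rewrite /hdiff /= !subr0; set K := hfloor _ _ _.
have ykE : y ord0 k = t * a ord0 k + (1 - t) * b ord0 k by rewrite yE !mxE.
rewrite {1 2}yk -(intrD _ K 1) !ler_int => /andP[nl nu].
rewrite intrD => /andP[bl bu] /andP[al au].
(* An integral coordinate is at an end of its range on the alcove, so no proper segment passes
   through it. *)
have : n = K \/ n = K + 1 by lia.
by case=> nE; rewrite yk nE ?intrD in ykE; nra.
Qed.

End Alcoves.

(** * The triangulation *)

Section Triangulation.
Variables (R : realType) (d : nat) (P : set 'rV[R]_d).
Local Notation I := (option 'I_d).
Hypotheses (polyP : polytope P) (unionP : union_of_closed_chambers P).

Lemma polytope_convex (a b : R) x y :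
  0 <= a -> 0 <= b -> a + b = 1 -> P x -> P y -> P (a *: x + b *: y).
Proof.
case: polyP => n [p ->] a0 b0 ab [w [w0 w1 ->]] [w' [w'0 w'1 ->]].
exists (fun i => a * w i + b * w' i); split.
- by move=> i; rewrite addr_ge0 ?mulr_ge0.
- by rewrite big_split -!mulr_sumr w1 w'1 !mulr1.
- rewrite !scaler_sumr -big_split; apply: eq_bigr => i _.
  by rewrite scalerDl !scalerA.
Qed.

Lemma polytope_bounded : exists B : nat, forall x k, P x -> `|x ord0 k| <= B%:R.
Proof.
case: polyP => n [p PE].
pose M := \sum_(i < n) \sum_(k < d) `|p i ord0 k|.
have pM i k : `|p i ord0 k| <= M.
  rewrite /M (bigD1 i) //= (bigD1 k) //= -addrA lerDl addr_ge0 //.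
    by apply: sumr_ge0.
  by apply: sumr_ge0 => j _; apply: sumr_ge0.
exists (Num.truncn M).+1 => x k; rewrite PE => -[w [w0 w1 ->]].
apply: (@le_trans _ _ M); last by apply/ltW; exact: truncnS_gt.
rewrite summxE; apply: le_trans (ler_norm_sum _ _ _) _.
rewrite -[leRHS]mul1r -w1 mulr_suml; apply: ler_sum => i _.
by rewrite mxE normrM ger0_norm // ler_wpM2l.
Qed.

Definition palcove (x : 'rV[R]_d) : Prop := generic x /\ (alcove x `<=` P)%classic.

Lemma union_palcove y : P y -> exists2 x, palcove x & alcove x y.
Proof.
case: unionP => Cs Csch PE Py; have := Py; rewrite PE => -[C CsC Cy].
have /chambersP[x gx CE] := Csch _ CsC; rewrite CE closure_open_alcove // in Cy.
exists x => //; split=> // z xz; rewrite PE; exists C => //.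
by rewrite CE closure_open_alcove.
Qed.

(** A generic point of a closed alcove lies in its interior, and so determines the same alcove. *)
Lemma generic_palcove y : P y -> generic y -> palcove y.
Proof.
move=> /union_palcove[x [gx xP] xy] gy; split=> //.
by rewrite (alcove_eq (hfloor_eq (alcove_generic xy gy))).
Qed.

Lemma chamber_palcove C v :
  (chambers C /\ (closure C `<=` P)%classic) /\ extreme_point (closure C) v ->
  exists2 x, palcove x & C = open_alcove x.
Proof.
by move=> [[/chambersP[x gx ->] CP] _]; exists x => //; split; rewrite // -closure_open_alcove.
Qed.

(** Boundedness of [P] makes the set of these lattice points finite, so [fset_set] does not return
    its default value. *)
Lemma tri_vertexP (v : 'rV[R]_d) :
  reflect (exists x, [/\ palcove x, alcove x v & lattice_point v])
          (v \in tri_vertices P).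
Proof.
have -> : tri_vertices P = fset_set
    [set v | exists x, [/\ palcove x, alcove x v & lattice_point v]]%classic.
  congr fset_set; apply/seteqP; split=> u /=.
    move=> [C [chC CP /[dup] uC]].
    have [x [gx xP] CE] := chamber_palcove (conj (conj chC CP) uC).
    by rewrite CE closure_open_alcove // => /extreme_alcove[xu lu]; exists x.
  move=> [x [[gx xP] xu lu]]; exists (open_alcove x).
  rewrite closure_open_alcove //; split=> //; last exact/extreme_alcove.
  by apply/chambersP; exists x.
rewrite in_fset_set; first by apply: (iffP idP); rewrite inE.
have [B PB] := polytope_bounded.
(* Enumerates the lattice points of the box with coordinates from [-B] to [B], shifted by [B]. *)
pose F (f : {ffun 'I_d -> 'I_(B.*2.+1)}) : 'rV[R]_d := \row_k ((f k)%:R - B%:R).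
apply: sub_finite_set (finite_image F (finite_finset (X := setT))) => u.
move=> [x [[gx xP] xu lu]]; have Pu := xP _ xu.
exists [ffun k => inord `|Num.floor (u ord0 k + B%:R)|%N] => //.
apply/rowP => k; rewrite mxE ffunE; have := PB _ k Pu; rewrite ler_norml => /andP[l h].
have /intrP[n un] := lu k; rewrite un in l h *.
have nB : (- (B%:Z) <= n <= B%:Z).
  by rewrite -!(ler_int R) mulrNz -!pmulrn l h.
rewrite -(intrD _ n B%:Z) intrKfloor inordK; last by lia.
rewrite natr_absz ger0_norm; last by lia.
by rewrite intrD addrK.
Qed.

Local Notation V := (tri_vertices P).
Local Notation T := (triangulation P).
Implicit Types (u v : V).

Lemma vertex_lattice v : lattice_point (val v).
Proof. by have /tri_vertexP[x []] := valP v. Qed.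

Lemma faceP (s : {set V}) :
  reflect (s = finset.set0 \/ exists2 x, palcove x & forall v, v \in s -> alcove x (val v))
          (s \in faces T).
Proof.
rewrite inE; apply: (iffP orP) => [[/eqP|/asboolP[C [chC CP sC]]]|].
- by left.
- right; have /chambersP[x gx CE] := chC.
  rewrite CE closure_open_alcove // in CP sC; exists x => // v /sC.
  by case/extreme_alcove.
- case=> [->|[x [gx xP] sx]]; [by left|right].
  apply/asboolP; exists (open_alcove x).
  rewrite closure_open_alcove //; split=> //; first by apply/chambersP; exists x.
  by move=> v /sx xv; apply/extreme_alcove; split=> //; exact: vertex_lattice.
Qed.

Definition zcoord v (i : I) : int := Num.floor (hcoord (val v) i).

Lemma zcoordE v i : hcoord (val v) i = (zcoord v i)%:~R.
Proof. by rewrite floorK // lattice_hcoord //; exact: vertex_lattice. Qed.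

Lemma zcoord0 v : zcoord v None = 0. Proof. exact: floor0. Qed.

Lemma zcoord_inj u v : (forall i, zcoord u i = zcoord v i) -> u = v.
Proof.
move=> uv; apply: val_inj; apply/rowP => k.
by have := zcoordE u (Some k); rewrite uv -zcoordE.
Qed.

Lemma zdiffE v i j : hdiff (val v) i j = (zcoord v i - zcoord v j)%:~R.
Proof. by rewrite /hdiff !zcoordE intrB. Qed.

Lemma alcove_zcoord x v :
  alcove x (val v) <-> forall i j,
    hfloor x i j <= zcoord v i - zcoord v j <= hfloor x i j + 1.
Proof.
split=> xv i j; have := xv i j.
  by rewrite zdiffE -(intrD _ _ 1) !ler_int.
by rewrite /= zdiffE -(intrD _ _ 1) !ler_int.
Qed.

Definition vset (x : 'rV[R]_d) : {set V} := [set v : V | `[< alcove x (val v) >]]%SET.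

Lemma vsetP x v : reflect (alcove x (val v)) (v \in vset x).
Proof. by rewrite inE; apply: asboolP. Qed.

Lemma vset_face x : palcove x -> vset x \in faces T.
Proof. by move=> px; apply/faceP; right; exists x => // v /vsetP. Qed.

Lemma hfloorD (x : 'rV[R]_d) (i j k : I) :
  hfloor x i j + hfloor x j k <= hfloor x i k <= hfloor x i j + hfloor x j k + 1.
Proof.
have /andP[l1 u1] := hfloor_itv x i j; have /andP[l2 u2] := hfloor_itv x j k.
rewrite /hfloor floor_ge_int intrD (hdiffD x i j k) lerD //=.
rewrite -ltzD1 floor_lt_int !intrD.
by rewrite /hfloor in u1 u2; lra.
Qed.

(** The vertex [i] of the alcove minimizes all differences with coordinate [i]: round [x_j - x_i]
    down for each [j], then translate so that the extra coordinate becomes 0. *)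
Lemma vertex_ex x i : palcove x ->
  exists2 v, v \in vset x & forall j, zcoord v j = hfloor x j i - hfloor x None i.
Proof.
move=> [gx xP].
pose r : 'rV[R]_d := \row_k (hfloor x (Some k) i - hfloor x None i)%:~R.
have rE j : hcoord r j = (hfloor x j i - hfloor x None i)%:~R.
  by case: j => [k|] /=; rewrite ?mxE // subrr.
have xr : alcove x r.
  move=> j k; rewrite /hdiff !rE -intrB -(intrD _ _ 1) !ler_int.
  by have := hfloorD x j k i; lia.
have lr : lattice_point r by move=> k; rewrite mxE intr_int.
have rV : r \in V by apply/tri_vertexP; exists x.
exists [` rV]%fset; first exact/vsetP.
by move=> j; rewrite /zcoord /= rE intrKfloor.
Qed.

Lemma alcove_spread x u v i j : alcove x (val u) -> alcove x (val v) ->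
  zcoord u i - zcoord v i <= zcoord u j - zcoord v j + 1.
Proof.
by move=> /alcove_zcoord/(_ i j) xu /alcove_zcoord/(_ i j) xv; lia.
Qed.

(** * The coloring and the facets *)

Definition zsum v : int := \sum_(k < d) zcoord v (Some k).

Definition color v : 'I_d.+1 := inord `|(zsum v %% d.+1)%Z|%N.

Lemma color_eq u v : color u = color v -> (d.+1 %| zsum u - zsum v)%Z.
Proof.
have lt_mod (w : V) : (0 <= (zsum w %% d.+1)%Z < d.+1%:Z).
  by rewrite modz_ge0 // ltz_pmod.
move=> /(congr1 val); rewrite /= !inordK; last first.
- by have := lt_mod v; lia.
- by have := lt_mod u; lia.
have := lt_mod u; have := lt_mod v; rewrite -eqz_mod_dvd => /andP[? _] /andP[? _].
by move=> E; apply/eqP; lia.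
Qed.

(** The coordinates of [u - v] are 0 or 1, so their sum lies between 0 and [d]; divisibility by
    [d + 1] makes it 0. *)
Lemma zsum_dvd_eq u v :
  (forall i, 0 <= zcoord u i - zcoord v i <= 1) -> (d.+1 %| zsum u - zsum v)%Z ->
  u = v.
Proof.
move=> uv; rewrite /zsum -sumrB => /dvdzP[q].
set D := \sum_(_ < _) _ => DE.
have D0 : 0 <= D by apply: sumr_ge0 => k _; have /andP[] := uv (Some k).
have Dd : D <= d%:Z.
  have -> : d%:Z = \sum_(k < d) 1 by rewrite sumr_const card_ord natz.
  by apply: ler_sum => k _; have /andP[] := uv (Some k).
have Dz : D = 0.
  have dE : (d.+1 : int) = d%:Z + 1 by lia.
  rewrite dE in DE; clearbody D; clear -D0 Dd DE.
  have d0 : 0 <= d%:Z by [].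
  have [q1|q1|q0] := ltrgtP q 0; [nia | nia | by rewrite DE q0 mul0r].
apply: zcoord_inj => -[k|]; last by rewrite !zcoord0.
have /eqP := Dz; rewrite psumr_eq0; last by move=> j _; have /andP[] := uv (Some j).
by move=> /allP/(_ k); rewrite mem_index_enum => /(_ isT)/= /eqP; lia.
Qed.

Lemma color_proper : proper_coloring T color.
Proof.
move=> s /faceP[->|[x px sx]] u v; first by rewrite inE.
move=> us vs /color_eq uv.
have xu := sx _ us; have xv := sx _ vs.
have bnd i : -1 <= zcoord u i - zcoord v i <= 1.
  have := alcove_spread i None xu xv; have := alcove_spread None i xu xv.
  by rewrite !zcoord0; lia.
(* Coordinates of [u - v] differ from each other by at most 1, so values 1 and -1 do not both occur:
   up to exchange, [u - v] is a 0/1 vector. *)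
have [[i ui]|nu] := pselect (exists i, zcoord u i - zcoord v i > 0).
  apply: zsum_dvd_eq uv => j.
  by have := alcove_spread i j xu xv; have := bnd j; lia.
apply/esym/zsum_dvd_eq; last by rewrite -opprB rpredN.
move=> i; have := bnd i.
have : ~ (zcoord u i - zcoord v i > 0) by move=> ui; apply: nu; exists i.
by lia.
Qed.

Lemma card_face_le s : s \in faces T -> (#|s| <= d.+1)%N.
Proof.
move=> sT; rewrite -(card_in_imset (color_proper sT)).
by rewrite (leq_trans (max_card _)) ?card_ord.
Qed.

(** The vertices of [vertex_ex] are [d + 1] distinct ones, since the difference of coordinates [i]
    and [j] is one larger at [w i] than at [w j]. The coloring allows no more. *)
Lemma wvertex_ex x : palcove x -> exists w : I -> V,
  [/\ forall i j, zcoord (w i) j = hfloor x j i - hfloor x None i,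
      vset x = [set w i | i : I]%SET & #|vset x| = d.+1].
Proof.
move=> px; have gx : generic x by case: px.
have wex i : exists v : V, v \in vset x /\
    forall j, zcoord v j = hfloor x j i - hfloor x None i.
  by have [v ? ?] := vertex_ex i px; exists v.
have [w wP] := choice wex.
have winj : injective w.
  move=> i j wij; apply/eqP/negPn/negP => ij.
  have /eqP := congr1 (fun v => zcoord v i - zcoord v j) wij.
  rewrite !(wP i).2 !(wP j).2 !hfloorxx (hfloorN gx ij); lia.
have sub : [set w i | i : I]%SET \subset vset x.
  by apply/fintype.subsetP => _ /imsetP[i _ ->]; case: (wP i).
have cardw : #|[set w i | i : I]%SET| = d.+1.
  by rewrite card_imset // card_option card_ord.
have vw : vset x = [set w i | i : I]%SET.
  by apply/esym/eqP; rewrite finset.eqEcard sub cardw card_face_le // vset_face.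
by exists w; split=> [i||]; [case: (wP i) | | rewrite vw].
Qed.

Lemma crank_tri x : palcove x -> crank T = d.+1.
Proof.
move=> px; apply/eqP; rewrite eqn_leq; apply/andP; split.
  by apply/bigmax_leqP => s; exact: card_face_le.
have [w [_ _ <-]] := wvertex_ex px.
exact: (@leq_bigmax_cond _ (fun s => s \in faces T) (fun s => #|s|) _ (vset_face px)).
Qed.

Lemma facetP x0 s : palcove x0 ->
  reflect (exists2 x, palcove x & s = vset x) (facet T s).
Proof.
move=> px0; rewrite /facet (crank_tri px0).
apply: (iffP andP) => [[/faceP sT /eqP scard]|[x px ->]]; last first.
  by split; [exact: vset_face | have [w [_ _ ->]] := wvertex_ex px].
case: sT => [s0|[x px sx]]; first by rewrite s0 cards0 in scard.
exists x => //; apply/eqP; rewrite finset.eqEcard scard.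
have [w [_ _ ->]] := wvertex_ex px; rewrite leqnn andbT.
by apply/fintype.subsetP => v /sx /vsetP.
Qed.

(** Each floor is the minimum of a coordinate difference over the vertices, attained at a vertex
    from [vertex_ex]. *)
Lemma vset_hfloor x y : palcove x -> palcove y -> vset x = vset y ->
  forall i j, hfloor x i j = hfloor y i j.
Proof.
have half x' y' i j : palcove x' -> vset x' = vset y' ->
    hfloor y' i j <= hfloor x' i j.
  move=> px' E; have [v] := vertex_ex j px'; rewrite E => /vsetP/alcove_zcoord/(_ i j).
  by move=> + vE; rewrite !vE hfloorxx; lia.
by move=> px py E i j; apply/eqP; rewrite eq_le !half.
Qed.

End Triangulation.

(** * Shelling the triangulation *)

Section TriangulationShelling.
Variables (R : realType) (d : nat) (P : set 'rV[R]_d).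
Local Notation I := (option 'I_d).
Hypotheses (polyP : polytope P) (unionP : union_of_closed_chambers P).
Local Notation V := (tri_vertices P).
Local Notation T := (triangulation P).
Implicit Types (u v : V) (s C D : {set V}) (i j : I).

Variable p : 'rV[R]_d.
Hypothesis pp : palcove P p.

(* The alcove [alcove x] is the one that a point of the relative interior of
   [s] enters when it is moved towards [p]. *)
Definition entered s (x : 'rV[R]_d) : Prop := forall i j, i != j ->
  (forall v, v \in s -> zcoord v i - zcoord v j = hfloor x i j) ->
  hfloor x i j <= hfloor p i j.

(** Start at the barycenter [f] of [s] and move slightly towards [p]. For the empty face every wall
    condition is vacuous, and [p] itself serves. *)
Lemma entered_ex s : s \in faces T ->
  exists x, [/\ palcove P x, s \subset vset P x & entered s x].
Proof.
have [-> _|[v0 v0s]] := finset.set_0Vmem s.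
  by exists p; split=> //; exact: finset.sub0set.
case/(faceP polyP) => [s0|[x0 [gx0 x0P] sx0]]; first by rewrite s0 inE in v0s.
have [gp pP] := pp.
have card_gt0 : 0 < #|s|%:R :> R by rewrite ltr0n card_gt0; apply/set0Pn; exists v0.
pose f : 'rV[R]_d := \sum_(v in s) #|s|%:R^-1 *: val v.
have fE i j : hdiff f i j * #|s|%:R = \sum_(v in s) (zcoord v i - zcoord v j)%:~R.
  have hcE k : hcoord f k * #|s|%:R = \sum_(v in s) hcoord (val v) k.
    case: k => [k|] /=; last by rewrite mul0r big1.
    rewrite /f summxE mulr_suml; apply: eq_bigr => v _.
    by rewrite mxE mulrC mulVKf ?gt_eqF.
  rewrite /hdiff mulrBl !hcE -sumrB; apply: eq_bigr => v _.
  by rewrite !(zcoordE polyP) intrB.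
have x0f : alcove x0 f.
  move=> i j; rewrite -(ler_pM2r card_gt0) -[X in _ && X](ler_pM2r card_gt0) fE.
  have sumE (a : R) : a * #|s|%:R = \sum_(v in s) a by rewrite sumr_const mulr_natr.
  rewrite !sumE; apply/andP; split; apply: ler_sum => v /sx0.
    by move=> /(alcove_zcoord polyP)/(_ i j)/andP[? _]; rewrite ler_int.
  move=> /(alcove_zcoord polyP)/(_ i j)/andP[_ ?].
  by rewrite -(intrD _ _ 1) ler_int.
have f_lt v i j : v \in s -> hdiff f i j < (zcoord v i - zcoord v j)%:~R + 1.
  move=> vs; rewrite -(ltr_pM2r card_gt0) fE mulr_natr -sumr_const.
  rewrite -subr_gt0 -sumrB (bigD1 v) //=; apply: ltr_wpDr; last by lra.
  apply: sumr_ge0 => u /andP[us _].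
  have /(alcove_zcoord polyP)/(_ i j) xu := sx0 _ us.
  have /(alcove_zcoord polyP)/(_ i j) xv := sx0 _ vs.
  rewrite subr_ge0 -(intrD _ _ 1) ler_int; lia.
have fl_gt (t : R) : t < (Num.floor t)%:~R + 1 by have := floorD1_gt t; rewrite intrD.
have [e [e0 e1 eP]] := small_step (I := (I * I)%type)
  (fun ij => hdiff p ij.1 ij.2 - hdiff f ij.1 ij.2)
  (fun ij => fl_gt (hdiff f ij.1 ij.2)).
pose x := (1 - e) *: f + e *: p.
have xE i j : hdiff x i j = hdiff f i j + e * (hdiff p i j - hdiff f i j).
  by rewrite hdiff_lin; ring.
have x_lt i j : hdiff x i j < (hfloor f i j)%:~R + 1 by rewrite xE (eP (i, j)).
have le_fl i j : hfloor x i j <= hfloor f i j.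
  by rewrite -ltzD1 floor_lt_int intrD x_lt.
have gx : generic x.
  move=> i j ij; apply/negP => /intrP[n xn].
  have fln i' j' (m : int) : hdiff x i' j' = m%:~R -> m%:~R <= hdiff f i' j'.
    move=> xm; have := x_lt i' j'; rewrite xm -(intrD _ _ 1) ltr_int ltzD1 => mf.
    by apply: le_trans (floor_le _); rewrite ler_int.
  have fn : hdiff f i j = n%:~R.
    apply/eqP; rewrite eq_le (fln _ _ _ xn) andbT.
    have := fln j i (- n); rewrite mulrNz [hdiff x _ _]hdiffC [hdiff f j i]hdiffC xn.
    by move=> /(_ erefl); rewrite lerN2.
  have := gp _ _ ij; rewrite (_ : hdiff p i j = n%:~R) ?intr_int //.
  have := xE i j; rewrite xn fn => H.
  have : e * (hdiff p i j - n%:~R) = 0 by lra.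
  by move/eqP; rewrite mulf_eq0 (gt_eqF e0) subr_eq0 => /eqP.
have px : palcove P x.
  apply: (generic_palcove unionP) => //; apply: (polytope_convex polyP); try lra.
    by apply: x0P.
  by apply/pP/open_alcove_sub/open_alcove_refl.
exists x; split=> //.
  apply/fintype.subsetP => v vs; apply/vsetP/(alcove_zcoord polyP) => i j.
  have lo i' j' : hfloor x i' j' <= zcoord v i' - zcoord v j'.
    apply: le_trans (le_fl _ _) _; rewrite -ltzD1 floor_lt_int intrD.
    exact: f_lt.
  have [->|ij] := eqVneq i j; first by rewrite hfloorxx subrr.
  by have := lo i j; have := lo j i; rewrite (hfloorN gx ij); lia.
move=> i j ij sE; have fE2 : hdiff f i j = (hfloor x i j)%:~R.
  apply: (mulIf (lt0r_neq0 card_gt0)); rewrite fE mulr_natr -sumr_const.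
  by apply: eq_bigr => v /sE ->.
have /andP[xl _] := hfloor_itv x i j; rewrite xE fE2 in xl.
rewrite /hfloor floor_ge_int.
have : 0 <= e * (hdiff p i j - (hfloor x i j)%:~R) by lra.
by rewrite pmulr_rge0 // subr_ge0.
Qed.

Definition base_point C : 'rV[R]_d :=
  xget p [set x | palcove P x /\ C = vset P x]%classic.

Lemma base_pointP C : facet T C ->
  palcove P (base_point C) /\ C = vset P (base_point C).
Proof.
move=> /(facetP polyP _ pp)[x px CE].
by apply: (@xgetPex _ p [set y | palcove P y /\ C = vset P y]%classic); exists x.
Qed.

(** The vertices of [C] opposite to the walls that separate [C] from the alcove of [p]. *)
Definition restriction C : {set V} := [set v in C |
  [exists i, exists j, [&& i != j,
     [forall u in C :\ v, zcoord u i - zcoord u j == hfloor (base_point C) i j] &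
     hfloor p i j < hfloor (base_point C) i j]]]%SET.

(** Twice the number of hyperplanes separating [C] from the alcove of [p], as each is counted for
    both orders of its pair. *)
Definition gallery_length C : nat :=
  (\sum_(ij : I * I) `|hfloor (base_point C) ij.1 ij.2 - hfloor p ij.1 ij.2|)%N.

(** If a vertex of the restriction were missing from [s], its opposite wall would contain [s] and
    separate [C] from [p]. *)
Lemma entered_restriction C s : facet T C -> s \subset C ->
  entered s (base_point C) -> restriction C \subset s.
Proof.
move=> fC sC ent; apply/fintype.subsetP => v; rewrite inE => /andP[vC].
case/existsP => i /existsP[j /and3P[ij /forall_inP CE lt_ij]].
apply: contraLR lt_ij => vs; rewrite -leNgt; apply: ent => // u us; apply/eqP.
apply: CE; rewrite !inE (fintype.subsetP sC) // andbT.
by apply: contraNneq vs => <-.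
Qed.

(** The hyperplanes to test contain [s] but need not be walls of [C]. The induction is on the number
    of vertices of [C] off the hyperplane: a single one makes it a wall, otherwise the inequality is
    a sum of two with fewer such vertices. *)
Lemma restriction_entered C s : facet T C -> s \subset C ->
  restriction C \subset s -> entered s (base_point C).
Proof.
move=> fC sC Rs; have [px CE] := base_pointP fC; set x := base_point C in px CE *.
have gx : generic x by case: px.
have [w [wE wC _]] := wvertex_ex polyP px; rewrite -CE in wC.
have wiC i : w i \in C by rewrite wC imset_f.
have Calc v : v \in C -> forall i j,
    hfloor x i j <= zcoord v i - zcoord v j <= hfloor x i j + 1.
  by rewrite CE => /vsetP/(alcove_zcoord polyP).
pose E i j := [set v in C | zcoord v i - zcoord v j == hfloor x i j + 1]%SET.
move=> i j; have [N] := ubnP #|E i j|; elim: N i j => // N IH i j EN ij sE.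
have wiE : w i \in E i j.
  by rewrite inE wiC !wE hfloorxx (hfloorN gx ij); apply/eqP; lia.
have [Ew|[v vE vi]] : (forall v, v \in E i j -> v = w i) \/
    exists2 v, v \in E i j & v != w i.
  have [/existsP[v /andP[? ?]]|/existsPn H] :=
    boolP [exists v, (v \in E i j) && (v != w i)]; first by right; exists v.
  by left=> v vE; apply/eqP; have := H v; rewrite vE negbK.
- rewrite leNgt; apply/negP => lt_ij.
  have : w i \in restriction C.
    rewrite inE wiC; apply/existsP; exists i; apply/existsP; exists j.
    rewrite ij lt_ij andbT; apply/forall_inP => u; rewrite !inE => /andP[ui uC].
    have := Calc _ uC i j; have : u \notin E i j by apply: contra ui => /Ew ->.
    rewrite inE uC -/x /= => /eqP; lia.
  move=> /(fintype.subsetP Rs)/sE; rewrite !wE hfloorxx (hfloorN gx ij); lia.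
have [a vE'] : exists a, v = w a.
  by have := vE; rewrite inE wC => /andP[/imsetP[a _ ->] _]; exists a.
have ia : i != a by apply: contraNneq vi => ->; rewrite vE'.
move: vE; rewrite vE' inE wiC !wE => /eqP aE.
have aj : a != j.
  by apply/eqP => aj; move: aE; rewrite aj hfloorxx; lia.
(* This additivity makes both [(i, a)] and [(a, j)] tight on [s], since their sum is. *)
have Kaj : hfloor x i a + hfloor x a j = hfloor x i j.
  by rewrite (hfloorN gx (_ : j != a)) 1?eq_sym //; lia.
have IHia : hfloor x i a <= hfloor p i a.
  apply: IH => // [|u us]; last first.
    have uC := fintype.subsetP sC _ us.
    by have := sE _ us; have := Calc _ uC i a; have := Calc _ uC a j; lia.
  rewrite -ltnS; apply: leq_trans EN; rewrite ltnS; apply: proper_card.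
  apply/properP; split; last first.
    exists (w a); rewrite !inE wiC !wE ?hfloorxx; first by apply/eqP; lia.
    by apply/negP => /= /eqP; lia.
  apply/fintype.subsetP => u; rewrite !inE => /andP[uC /eqP uE]; rewrite uC /=.
  by apply/eqP; have := Calc _ uC i j; have := Calc _ uC a j; lia.
have IHaj : hfloor x a j <= hfloor p a j.
  apply: IH => // [|u us]; last first.
    have uC := fintype.subsetP sC _ us.
    by have := sE _ us; have := Calc _ uC i a; have := Calc _ uC a j; lia.
  rewrite -ltnS; apply: leq_trans EN; rewrite ltnS; apply: proper_card.
  apply/properP; split; last first.
    exists (w i) => //; rewrite !inE wiC !wE (hfloorN gx ia) (hfloorN gx ij).
    by apply/negP => /= /eqP; lia.
  apply/fintype.subsetP => u; rewrite !inE => /andP[uC /eqP uE]; rewrite uC /=.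
  by apply/eqP; have := Calc _ uC i j; have := Calc _ uC i a; lia.
by have := hfloorD p i a j; lia.
Qed.

Lemma restriction_ex s : s \in faces T ->
  exists C, [/\ facet T C, restriction C \subset s & s \subset C].
Proof.
move=> sT; have [x [px sx ent]] := entered_ex sT.
have fC : facet T (vset P x) by apply/(facetP polyP _ pp); exists x.
exists (vset P x); split=> //; apply: entered_restriction => // i j ij.
have [pb CE] := base_pointP fC.
by rewrite -(vset_hfloor polyP px pb CE); apply: ent.
Qed.

(** Every hyperplane separating [C] from [D] contains [restriction C], so by [restriction_entered]
    it has [C] on the side of [p]. *)
Lemma restriction_length C D : facet T C -> facet T D -> C != D ->
  restriction C \subset D -> (gallery_length C < gallery_length D)%N.
Proof.
move=> fC fD CD RD; have [pC CE] := base_pointP fC; have [pD DE] := base_pointP fD.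
have RC : restriction C \subset C by apply/fintype.subsetP => v; rewrite inE => /andP[].
have ent := restriction_entered fC RC (fintype.subxx _).
set x := base_point C in pC CE ent; set y := base_point D in pD DE.
have gx : generic x by case: pC.
have gy : generic y by case: pD.
have Rx v i j : v \in restriction C ->
    hfloor x i j <= zcoord v i - zcoord v j <= hfloor x i j + 1.
  by move/(fintype.subsetP RC); rewrite CE => /vsetP/(alcove_zcoord polyP).
have Ry v i j : v \in restriction C ->
    hfloor y i j <= zcoord v i - zcoord v j <= hfloor y i j + 1.
  by move/(fintype.subsetP RD); rewrite DE => /vsetP/(alcove_zcoord polyP).
have dist i j : hfloor x i j != hfloor y i j ->
    (`|hfloor x i j - hfloor p i j| < `|hfloor y i j - hfloor p i j|)%N.
  have [->|ij] := eqVneq i j; first by rewrite !hfloorxx eqxx.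
  have [gp _] := pp; rewrite neq_lt => /orP[xy|yx].
    (* [entered] bounds differences from one side only; this case needs the reversed pair. *)
    have := ent j i; rewrite eq_sym ij => /(_ isT).
    rewrite (hfloorN gx ij) (hfloorN gp ij) => H.
    have {H} : -1 - hfloor x i j <= -1 - hfloor p i j.
      by apply: H => v vR; have := Rx _ i j vR; have := Ry _ i j vR; lia.
    by lia.
  have : hfloor x i j <= hfloor p i j.
    by apply: ent => // v vR; have := Rx _ i j vR; have := Ry _ i j vR; lia.
  by lia.
have [ij neq_ij] : exists ij : I * I, hfloor x ij.1 ij.2 != hfloor y ij.1 ij.2.
  apply: contrapT => H; case/eqP: CD; rewrite CE DE.
  apply/setP => v; apply/vsetP/vsetP; rewrite (@alcove_eq _ _ y x) // => i j;
  by apply/eqP/negPn/negP => neq; apply: H; exists (i, j).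
rewrite /gallery_length (bigD1 ij) //= [X in (_ < X)%N](bigD1 ij) //=.
rewrite -addSn leq_add ?dist // leq_sum // => kl _.
by have [->//|/dist/ltnW] := eqVneq (hfloor x kl.1 kl.2) (hfloor y kl.1 kl.2).
Qed.

End TriangulationShelling.

(** * Symmetries and lattice points *)

Section Symmetry.
Variables (R : realType) (d : nat).
Local Notation I := (option 'I_d).
Implicit Types (x y : 'rV[R]_d) (s t : 'S_d).

Lemma hcoord_act s x (i : I) : hcoord (coord_act s x) i = hcoord x (omap s i).
Proof. by case: i => [i|] //=; rewrite mxE. Qed.

Lemma hdiff_act s x (i j : I) :
  hdiff (coord_act s x) i j = hdiff x (omap s i) (omap s j).
Proof. by rewrite /hdiff !hcoord_act. Qed.

Lemma hfloor_act s x (i j : I) :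
  hfloor (coord_act s x) i j = hfloor x (omap s i) (omap s j).
Proof. by rewrite /hfloor hdiff_act. Qed.

Lemma coord_actM s t x : coord_act (s * t)%g x = coord_act s (coord_act t x).
Proof. by apply/rowP => k; rewrite !mxE permM. Qed.

Lemma coord_act1 x : coord_act 1%g x = x.
Proof. by apply/rowP => k; rewrite mxE perm1. Qed.

Lemma generic_act s x : generic x -> generic (coord_act s x).
Proof.
move=> gx i j ij; rewrite hdiff_act; apply: gx.
apply: contraNneq ij; case: i j => [i|] [j|] //= [] /perm_inj ->.
by rewrite eqxx.
Qed.

Lemma alcove_act s x y : alcove x y -> alcove (coord_act s x) (coord_act s y).
Proof. by move=> xy i j; rewrite hfloor_act hdiff_act; apply: xy. Qed.

Lemma lattice_act s x : lattice_point x -> lattice_point (coord_act s x).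
Proof. by move=> lx k; rewrite mxE. Qed.

End Symmetry.

(** A vertex and its image in a common face have equal colors, hence coincide: [s] is fixed
    pointwise. *)
Lemma translative_coloring (V : finType) (K : scomplex V) (G : Type)
    (act : G -> V -> V) (Gam : finType) (gam : V -> Gam) :
  proper_coloring K gam -> preserves_coloring act gam -> translative K act.
Proof.
move=> prop pres g s sK [t tK /andP[st gst]].
have fix_s v : v \in s -> act g v = v.
  move=> vs; apply: (prop _ tK); rewrite ?pres //.
    by apply: (fintype.subsetP gst); rewrite imset_f.
  exact: (fintype.subsetP st).
apply/setP => v; apply/imsetP/idP => [[u us ->]|vs]; first by rewrite fix_s.
by exists v; rewrite ?fix_s.
Qed.

Section TriangulationSymmetry.
Variables (R : realType) (d : nat) (P : set 'rV[R]_d).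
Local Notation I := (option 'I_d).
Hypotheses (polyP : polytope P) (unionP : union_of_closed_chambers P).
Local Notation V := (tri_vertices P).
Local Notation T := (triangulation P).
Variable s : 'S_d.
Hypothesis sP : [set coord_act s x | x in P]%classic = P.

Lemma palcove_act x : palcove P x -> palcove P (coord_act s x).
Proof.
move=> [gx xP]; split; first exact: generic_act.
move=> z /(alcove_act s^-1%g); rewrite -coord_actM mulVg coord_act1 => /xP Pz.
rewrite -sP; exists (coord_act s^-1%g z) => //.
by rewrite -coord_actM mulgV coord_act1.
Qed.

Lemma val_tri_act (v : V) : val (tri_act P s v) = coord_act s (val v).
Proof.
rewrite val_insubd (_ : _ \in _ = true) //; apply/(tri_vertexP polyP).
have /(tri_vertexP polyP)[x [px xv lv]] := valP v.
by exists (coord_act s x); split; [exact: palcove_act | exact: alcove_act | exact: lattice_act].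
Qed.

Lemma zcoord_act (v : V) (i : I) : zcoord (tri_act P s v) i = zcoord v (omap s i).
Proof. by rewrite /zcoord val_tri_act hcoord_act. Qed.

Lemma color_act (v : V) : color (tri_act P s v) = color v.
Proof.
rewrite /color (_ : zsum (tri_act P s v) = zsum v) //.
rewrite /zsum [RHS](reindex_inj (@perm_inj _ s)) /=.
by apply: eq_bigr => k _; rewrite zcoord_act.
Qed.

Lemma tri_act_face (t : {set V}) : t \in faces T -> tri_act P s @: t \in faces T.
Proof.
move=> /(faceP polyP)[->|[x px xt]]; apply/(faceP polyP).
  by left; rewrite imset0.
right; exists (coord_act s x); first exact: palcove_act.
by move=> _ /imsetP[v vt ->]; rewrite val_tri_act; apply/alcove_act/xt.
Qed.

End TriangulationSymmetry.

(** * Lattice points of dilates as monomials *)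

(** Hermite's identity. Raising [n] by 1 shifts the summands and replaces the first by itself plus
    1. *)
Lemma sum_floor (R : realType) (m : nat) (n : int) :
  \sum_(j < m.+1) Num.floor ((n%:~R + j%:R) / m.+1%:R : R) = n.
Proof.
have mR : 0 < m.+1%:R :> R by rewrite ltr0n.
pose f (k : int) := \sum_(j < m.+1) Num.floor ((k%:~R + j%:R) / m.+1%:R : R).
pose F (k : int) := Num.floor (k%:~R / m.+1%:R : R).
have fE k : f k = \sum_(0 <= j < m.+1) F (k + j%:Z).
  by rewrite big_mkord; apply: eq_bigr => j _; rewrite /F intrD.
have fS k : f (k + 1) = f k + 1.
  have FS : F (k + m.+1%:Z) = F k + 1.
    rewrite /F intrD mulrDl -[m.+1%:Z%:~R]/(m.+1%:R) divff ?gt_eqF //.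
    by rewrite floorDrz ?floor1 // int_num1.
  rewrite !fE big_nat_recr //= [in RHS]big_nat_recl //= addr0.
  rewrite (_ : k + 1 + m%:Z = k + m.+1%:Z) ?FS; last by lia.
  rewrite (eq_bigr (fun j : nat => F (k + j.+1%:Z))) => [|j _]; last by congr F; lia.
  ring.
have f0 : f 0 = 0.
  rewrite /f big1 // => j _; apply: floor_def; rewrite !add0r divr_ge0 //=.
  by rewrite ltr_pdivrMr // mul1r ltr_nat.
rewrite -[LHS]/(f n); elim/int_ind: n => [//|n IH|n IH].
  by rewrite intS addrC fS IH.
apply: (addIr 1); rewrite -fS.
by rewrite (_ : - (n.+1%:Z) + 1 = - n%:Z) //; lia.
Qed.

Section LatticePoints.
Variables (R : realType) (d : nat) (P : set 'rV[R]_d).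
Local Notation I := (option 'I_d).
Hypotheses (polyP : polytope P) (unionP : union_of_closed_chambers P).
Local Notation V := (tri_vertices P).
Local Notation T := (triangulation P).

Definition weighted_sum (c : V -> nat) (i : I) : int := \sum_v (c v)%:Z * zcoord v i.

(* The multiplicity of [v] among the [m] roundings of [z / m]. *)
Definition multiplicity (m : nat) (z : I -> int) (v : V) : nat :=
  #|[set j : 'I_m | [forall i, ((z i + j%:Z) %/ m)%Z == zcoord v i]]%SET|.

Lemma sum_multiplicity m z : (\sum_v multiplicity m z v <= m)%N.
Proof.
rewrite /multiplicity; under eq_bigr do rewrite -sum1_card big_mkcond.
rewrite exchange_big /= -[leqRHS]card_ord -[leqRHS]sum1_card leq_sum // => j _.
have [/existsP[v vj]|/existsPn nv] :=
  boolP [exists v : V, [forall i, ((z i + j%:Z) %/ m)%Z == zcoord v i]].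
  rewrite (bigD1 v) //= big1 ?addn0; first by case: ifP.
  move=> u uv; rewrite inE; case: forallP => // uj; case/eqP: uv.
  apply: (zcoord_inj polyP) => i.
  by rewrite -(eqP (uj i)) (eqP (forallP vj i)).
by rewrite big1 // => v _; rewrite inE (negbTE (nv v)).
Qed.

Lemma weight_le_multiplicity m (c : V -> nat) x : (\sum_v c v)%N = m ->
  (forall v, c v != 0%N -> alcove x (val v)) ->
  forall v, (c v <= multiplicity m (weighted_sum c) v)%N.
Proof.
move=> cm cx v; have [->//|cv0] := eqVneq (c v) 0%N.
pose below u := (u != v) && [forall i, zcoord u i <= zcoord v i].
pose N := (\sum_(u | below u) c u)%N.
have sumD : (N + c v + \sum_(u | ~~ below u && (u != v)) c u = m)%N.
  rewrite -cm [RHS](bigID below) /= -addnA; congr (_ + _)%N.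
  by rewrite [RHS](bigD1 v) // /below eqxx.
have hm (k : 'I_(c v)) : (N + k < m)%N by have := ltn_ord k; lia.
pose h (k : 'I_(c v)) : 'I_m := Ordinal (hm k).
have h_inj : injective h.
  by move=> k l /(congr1 val) /= /eqP; rewrite eqn_add2l => /eqP/val_inj.
rewrite -{1}(card_ord (c v)) -cardsT -(card_imset _ h_inj); apply: subset_leq_card.
apply/fintype.subsetP => _ /imsetP[k _ ->]; rewrite inE; apply/forallP => i /=.
set q := zcoord v i; have xv := cx _ cv0.
pose D : int := \sum_u (c u)%:Z * (zcoord u i - q).
have zE : weighted_sum c i = q * m%:Z + D.
  rewrite /D /weighted_sum -cm -natz natr_sum mulr_sumr -big_split /=.
  by apply: eq_bigr => u _; rewrite natz; ring.
have sumz (Q : pred V) (b : V -> nat) :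
    (\sum_(u | Q u) b u)%N%:Z = \sum_(u | Q u) (b u)%:Z.
  by rewrite -natz natr_sum; apply: eq_bigr => u _; rewrite natz.
(* Relative to [v], coordinates vary by at most 1 and decrease only at vertices below [v]; so
   [D + N + k] is a remainder modulo [m]. *)
have lo : - N%:Z <= D.
  rewrite /D sumz [X in - X]big_mkcond -sumrN; apply: ler_sum => u _.
  have [->|/cx xu] := eqVneq (c u) 0%N; first by case: ifP; rewrite ?mul0r ?oppr0.
  have u1 := alcove_spread polyP i None xv xu; rewrite !zcoord0 in u1.
  have cu : 0 <= (c u)%:Z by [].
  case: ifPn => [_|nb]; rewrite -/q in u1 *; first by nia.
  have [uq|uq] := lerP q (zcoord u i); first by nia.
  case/negP: nb; rewrite /below; apply/andP; split.
    by apply: contraTneq uq => ->; rewrite ltxx.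
  apply/forallP => j; have := alcove_spread polyP i j xv xu; rewrite -/q; lia.
have hi : D <= (\sum_(u | ~~ below u && (u != v)) c u)%N%:Z.
  rewrite /D sumz [leRHS]big_mkcond; apply: ler_sum => u _.
  have [->|/cx xu] := eqVneq (c u) 0%N; first by case: ifP; rewrite ?mul0r.
  have u1 := alcove_spread polyP i None xu xv; rewrite !zcoord0 in u1.
  have cu : 0 <= (c u)%:Z by [].
  have [/andP[_ /forallP/(_ i)]|_] /= := boolP (below u); first by rewrite -/q; nia.
  by have [->|_] /= := eqVneq u v; rewrite -/q ?subrr ?mulr0 //; rewrite -/q in u1; nia.
have m0 : m != 0%N by have := hm k; lia.
have kc := ltn_ord k.
rewrite zE -addrA divzMDl // divz_small ?addr0 //.
by apply/andP; split; lia.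
Qed.

(** The pointwise bound is an equality because the multiplicities sum to at most [m], the sum of
    [c]. *)
Lemma weight_multiplicity m (c : V -> nat) x : (\sum_v c v)%N = m ->
  (forall v, c v != 0%N -> alcove x (val v)) ->
  forall v, c v = multiplicity m (weighted_sum c) v.
Proof.
move=> cm cx v; have le := weight_le_multiplicity cm cx.
apply/eqP; rewrite eqn_leq le /= leqNgt; apply/negP => lt_v.
have := sum_multiplicity m (weighted_sum c); rewrite leqNgt => /negP; apply.
rewrite -[ltnLHS]cm (bigD1 v) //= [ltnRHS](bigD1 v) //= -addSn leq_add //.
by apply: leq_sum.
Qed.

(** Adding [j / m] and rounding down satisfies the conditions of [alcove_map]; it fixes 0 because
    [j < m]. *)
Lemma rounding_ex m x (y : 'rV[R]_d) (j : 'I_m) : palcove P x -> alcove x y ->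
  exists v : V, alcove x (val v) /\
    forall k, val v ord0 k = (Num.floor (y ord0 k + j%:R / m%:R))%:~R.
Proof.
move=> px xy; have m0 : (0 < m)%N by apply: leq_ltn_trans (ltn_ord j).
have mR : 0 < m%:R :> R by rewrite ltr0n.
pose g (t : R) : R := (Num.floor (t + j%:R / m%:R))%:~R.
have xg : alcove x (map_coord g y).
  apply: alcove_map xy => [a b ab|a n|].
  - by rewrite ler_int le_floor // lerD2r.
  - by rewrite /g addrAC floorDrz ?intr_int // intrKfloor intrD.
  - rewrite /g add0r (floor_def (m := 0)) // divr_ge0 //= add0r.
    by rewrite ltr_pdivrMr // mul1r ltr_nat.
have gV : map_coord g y \in V.
  apply/(tri_vertexP polyP); exists x; split=> // k.
  by rewrite mxE intr_int.
by exists [` gV]%fset; split=> // k; rewrite mxE.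
Qed.

Definition monomial_point (m : 'X_{1..#|{: V}|}) : 'rV[R]_d :=
  \sum_(v : V) (m (enum_rank v))%:R *: val v.

Lemma monomial_point_hcoord m i :
  hcoord (monomial_point m) i = (weighted_sum (fun v => m (enum_rank v)) i)%:~R.
Proof.
rewrite /weighted_sum rmorph_sum /=; case: i => [k|] /=.
  rewrite summxE; apply: eq_bigr => v _.
  by rewrite mxE intrM -(zcoordE polyP v (Some k)).
by rewrite big1 // => v _; rewrite zcoord0 mulr0.
Qed.

Lemma mdeg_enum_rank (m : 'X_{1..#|{: V}|}) : mdeg m = (\sum_v m (enum_rank v))%N.
Proof.
rewrite mdegE (reindex_onto enum_rank enum_val) /= => [|i _]; last by rewrite enum_valK.
by apply: eq_bigl => v; rewrite enum_rankK eqxx.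
Qed.

Lemma face_alcove (m : 'X_{1..#|{: V}|}) : msupport m \in faces T ->
  exists x, forall v, m (enum_rank v) != 0%N -> alcove x (val v).
Proof.
move=> /(faceP polyP)[m0|[x px xm]].
  exists 0 => v mv; suff : v \in msupport m by rewrite m0 inE.
  by rewrite inE.
by exists x => v mv; apply: xm; rewrite inE.
Qed.

(** [weight_multiplicity] recovers the exponents from the degree and the point alone. *)
Lemma monomial_point_inj (m m' : 'X_{1..#|{: V}|}) : mdeg m = mdeg m' ->
  msupport m \in faces T -> msupport m' \in faces T -> monomial_point m = monomial_point m' -> m = m'.
Proof.
move=> dE /face_alcove[x xm] /face_alcove[x' xm'] lE; apply/mnmP => k.
rewrite -(enum_valK k).
rewrite (weight_multiplicity (esym (mdeg_enum_rank m)) xm).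
rewrite (weight_multiplicity (esym (mdeg_enum_rank m')) xm') dE.
congr (multiplicity _ _ _); apply/funext => i; apply/eqP.
by rewrite -(eqr_int R) -!monomial_point_hcoord lE.
Qed.

Lemma monomial_point_lattice m : lattice_point (monomial_point m).
Proof. by move=> k; have := monomial_point_hcoord m (Some k) => /= ->; rewrite intr_int. Qed.

Lemma monomial_point_dilate k (m : face_monomial T k.+1) : dilate k.+1 P (monomial_point (val m)).
Proof.
have [/eqP dm sm] := andP (valP m).
have kR : 0 < k.+1%:R :> R by rewrite ltr0n.
pose c v := val m (enum_rank v); have cm : (\sum_v c v)%N = k.+1.
  by rewrite -mdeg_enum_rank.
exists (\sum_(v : V) ((c v)%:R / k.+1%:R) *: val v); last first.
  rewrite scaler_sumr; apply: eq_bigr => v _.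
  by rewrite scalerA mulrC mulfVK ?gt_eqF.
case/(faceP polyP): sm => [m0|[x [gx xP] xm]].
  have : (\sum_v c v)%N = 0%N.
    rewrite big1 // => v _; apply/eqP/negPn/negP => cv.
    by have : v \in msupport (val m); [rewrite inE | rewrite m0 inE].
  by rewrite cm.
apply: xP => i j.
have hE l : hcoord (\sum_(v : V) ((c v)%:R / k.+1%:R) *: val v) l =
    (\sum_(v : V) (c v)%:R * hcoord (val v) l) / k.+1%:R.
  case: l => [l|] /=; last by rewrite big1 ?mul0r // => v _; rewrite mulr0.
  rewrite summxE mulr_suml; apply: eq_bigr => v _; rewrite mxE; ring.
rewrite /hdiff !hE -mulrBl -sumrB ler_pdivlMr // ler_pdivrMr // -cm natr_sum.
rewrite !mulr_sumr; apply/andP; split; apply: ler_sum => v _; rewrite -mulrBr.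
  have [->|cv] := eqVneq (c v) 0%N; first by rewrite mul0r mulr0.
  rewrite mulrC ler_wpM2l //; have vs : v \in msupport (val m) by rewrite inE.
  by have /andP[] := xm _ vs i j.
have [->|cv] := eqVneq (c v) 0%N; first by rewrite mul0r mulr0.
rewrite [leRHS]mulrC ler_wpM2l //; have vs : v \in msupport (val m) by rewrite inE.
by have /andP[] := xm _ vs i j.
Qed.

(** The monomial counts the [k + 1] roundings of [y], which are vertices of one alcove; Hermite's
    identity in each coordinate shows that they sum to [z]. *)
Lemma monomial_point_surj k (z : 'rV[R]_d) : dilate k.+1 P z -> lattice_point z ->
  exists m : face_monomial T k.+1, monomial_point (val m) = z.
Proof.
move=> [y Py <-{z}] lz; have [x px xy] := union_palcove unionP Py.
have kR : k.+1%:R != 0 :> R by rewrite pnatr_eq0.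
have [w wP] := choice (fun j : 'I_k.+1 => rounding_ex j px xy).
pose c v := #|[set j | w j == v]%SET|.
pose m := [multinom c (enum_val i) | i < #|{: V}|].
have mE v : m (enum_rank v) = c v by rewrite mnmE enum_rankK.
have dm : mdeg m = k.+1.
  rewrite mdeg_enum_rank; under eq_bigr do rewrite mE /c -sum1_card.
  transitivity (\sum_(j < k.+1) 1)%N; last by rewrite sum1_card card_ord.
  rewrite [RHS](partition_big w predT) //=; apply: eq_bigr => v _.
  by apply: eq_bigl => j; rewrite inE.
have sm : msupport m \in faces T.
  apply/(faceP polyP); right; exists x => // v; rewrite inE mE -lt0n.
  by move=> /card_gt0P[j]; rewrite inE => /eqP <-; case: (wP j).
have dm1 : (mdeg m < k.+2)%N by rewrite dm.
have mP : (mdeg (BMultinom dm1) == k.+1) && (msupport (BMultinom dm1) \in faces T).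
  by rewrite /= dm eqxx.
exists (Sub (BMultinom dm1) mP : face_monomial T k.+1) => /=.
have -> : monomial_point m = \sum_(j < k.+1) val (w j).
  rewrite [RHS](partition_big w predT) //=; apply: eq_bigr => v _.
  rewrite mE /c -sum1_card natr_sum scaler_suml; apply: eq_big => j; first by rewrite inE.
  by rewrite inE => /eqP ->; rewrite scale1r.
apply/rowP => l; rewrite summxE !mxE; under eq_bigr do rewrite (wP _).2.
have /intrP[n nE] := lz l; rewrite mxE in nE; rewrite nE.
rewrite -(sum_floor R k n) [RHS]rmorph_sum; apply: eq_bigr => j _ /=.
by congr (Num.floor _)%:~R; rewrite mulrDl -nE mulrAC divff ?mul1r.
Qed.

Variable s : 'S_d.
Hypothesis sP : [set coord_act s x | x in P]%classic = P.
Hypothesis inj_s : injective (tri_act P s).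

Lemma monomial_point_act (m : 'X_{1..#|{: V}|}) :
  monomial_point (monomial_act inj_s m) = coord_act s (monomial_point m).
Proof.
rewrite /monomial_point [LHS](reindex_inj inj_s) /=; apply/rowP => k.
rewrite mxE !summxE; apply: eq_bigr => v _.
by rewrite !mxE monomial_actE (val_tri_act polyP sP) mxE.
Qed.

(** The bijection between monomials and lattice points is equivariant, so it matches fixed
    points. *)
Lemma card_fixed_lattice k :
  #|` fset_set [set x | [/\ dilate k.+1 P x, lattice_point x & coord_act s x = x]]%classic| =
  #|[set m : face_monomial T k.+1 |
      monomial_act inj_s (val m) == val m :> 'X_{1..#|{: V}|}]%SET|.
Proof.
set L := [set x | _]%classic; set A := finset _.
have LA x : L x <-> exists2 m, m \in A & x = monomial_point (val m).
  split=> [[Px lx sx]|[m]]; last first.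
    rewrite inE => /eqP mA ->; split; [exact: monomial_point_dilate | exact: monomial_point_lattice |].
    by rewrite -monomial_point_act mA.
  have [m mx] := monomial_point_surj Px lx; exists m => //; rewrite inE; apply/eqP.
  have [/eqP dm sm] := andP (valP m).
  apply: monomial_point_inj => //; rewrite ?monomial_act_deg ?monomial_point_act ?mx //.
  by rewrite monomial_act_support (tri_act_face polyP sP).
have finL : finite_set L.
  apply: sub_finite_set (finite_image (fun m : face_monomial T k.+1 => monomial_point (val m))
    (finite_finset (X := setT))) => x /LA[m _ ->].
  by exists m.
rewrite cardE -(size_map (fun m : face_monomial T k.+1 => monomial_point (val m))).
apply/perm_size/uniq_perm.
- exact: fset_uniq.
- rewrite map_inj_in_uniq ?enum_uniq // => m m' _ _ lE; apply: val_inj; apply: val_inj.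
  have [/eqP dm sm] := andP (valP m); have [/eqP dm' sm'] := andP (valP m').
  by apply: monomial_point_inj => //; rewrite dm dm'.
- move=> x; rewrite in_fset_set //; apply/idP/mapP => [|[m mA ->]].
    by rewrite inE => /LA[m mA ->]; exists m; rewrite ?mem_enum.
  by rewrite inE; apply/LA; exists m; rewrite // -mem_enum.
Qed.

End LatticePoints.

(** * Degenerate cases and conclusion *)

Lemma tri_shellable (R : realType) (d : nat) (P : set 'rV[R]_d) :
  polytope P -> union_of_closed_chambers P ->
  exists (Rs : {set tri_vertices P} -> {set tri_vertices P}) len,
    (forall s, s \in faces (triangulation P) ->
       exists C, [/\ facet (triangulation P) C, Rs C \subset s & s \subset C]) /\
    (forall C D, facet (triangulation P) C -> facet (triangulation P) D ->
       C != D -> Rs C \subset D -> (len C < len D)%N).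
Proof.
move=> polyP unionP; have [[p pp]|noP] := pselect (exists p, palcove P p).
  exists (restriction p), (gallery_length p); split.
    exact: restriction_ex.
  exact: restriction_length.
have V0 (s : {set tri_vertices P}) : s = finset.set0.
  apply/setP => v; rewrite inE; have /(tri_vertexP polyP)[x [px _ _]] := valP v.
  by case: noP; exists x.
(* Without alcoves the empty face is the only face and the only facet, so the length condition is
   vacuous. *)
exists id, (fun=> 0%N); split=> [s sT|C D _ _]; last by rewrite (V0 C) (V0 D) eqxx.
exists s; rewrite !fintype.subxx; split=> //; rewrite /facet sT eqn_leq.
rewrite (V0 s) cards0 /=; apply/bigmax_leqP => t _.
by rewrite (V0 t) cards0.
Qed.

Lemma tri_balanced_coloring (R : realType) (d : nat) (P : set 'rV[R]_d) :
  polytope P ->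
  exists (Gam : finType) (gam : tri_vertices P -> Gam),
    [/\ proper_coloring (triangulation P) gam, balanced (triangulation P) Gam &
        forall s : 'S_d, [set coord_act s x | x in P]%classic = P ->
          forall v, gam (tri_act P s v) = gam v].
Proof.
move=> polyP; have [[p pp]|noP] := pselect (exists p, palcove P p).
  exists ('I_d.+1 : finType), (@color R d P); split.
  - exact: color_proper.
  - by rewrite /balanced card_ord (crank_tri polyP pp).
  - by move=> s sP v; apply: color_act.
(* Without alcoves there are no vertices and [crank] is 0, so the color set must be empty. *)
have noV (v : tri_vertices P) : False.
  have /(tri_vertexP polyP)[x [px _ _]] := valP v.
  by apply: noP; exists x.
exists (void : finType), (fun v => match noV v with end); split.
- by move=> s _ u; case: (noV u).
- rewrite /balanced card_void; apply/esym/eqP; rewrite -leqn0.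
  apply/bigmax_leqP => t _; rewrite leqn0 cards_eq0; apply/eqP/setP => v.
  by case: (noV v).
- by move=> s _ v; case: (noV v).
Qed.

Lemma card_face_monomial0 (V : finType) (K : scomplex V) (f : V -> V)
    (inj_f : injective f) :
  #|[set m : face_monomial K 0 |
      monomial_act inj_f (val m) == val m :> 'X_{1..#|V|}]%SET| = 1%N.
Proof.
have supp0 : msupport (0 : 'X_{1..#|V|})%MM = finset.set0 :> {set V}.
  by apply/setP => v; rewrite !inE mnm0E.
have m0 : (mdeg (0%MM : 'X_{1..#|V|}) < 1)%N by rewrite mdeg0.
have mP : (mdeg (BMultinom m0) == 0%N) && (msupport (BMultinom m0) \in faces K).
  by rewrite /= mdeg0 supp0 faces0.
rewrite (_ : finset _ = [set (Sub (BMultinom m0) mP : face_monomial K 0)]%SET) ?cards1 //.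
apply/setP => m; rewrite !inE.
have mE : m = Sub (BMultinom m0) mP :> face_monomial K 0.
  apply: val_inj; apply: val_inj => /=; apply/eqP; rewrite -mdeg_eq0.
  by have /andP[] := valP m.
rewrite mE eqxx; apply/eqP/mnmP => i.
by rewrite /= mnmE !mnm0E.
Qed.

Theorem theorem7p8 (R : realType) (d : nat) (P : set 'rV[R]_d)
    (G : groupType) (rho : {multiplicative G -> 'S_d}) :
  polytope P ->
  union_of_closed_chambers P ->
  (forall g : G, [set coord_act (rho g) x | x in P]%classic = P) ->
  let T := triangulation P in
  let act (g : G) := tri_act P (rho g) in
  [/\ translative T act,
      exists (Gam : finType) (gam : tri_vertices P -> Gam),
        [/\ proper_coloring T gam, balanced T Gam &
            preserves_coloring act gam],
      equiv_ehrhart_series (R[i]) (fun g => coord_act (rho g)) P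
        = equiv_hilbert_series (R[i]) T act,
      forall k : nat, (k <= crank T)%N -> effective (equiv_h (R[i]) T act k) &
      forall (Gam : finType) (gam : tri_vertices P -> Gam),
        proper_coloring T gam -> balanced T Gam ->
        preserves_coloring act gam ->
        forall S : {set Gam},
          effective (equiv_flag_h (R[i]) T act gam S)].
Proof.
move=> polyP unionP GP T act.
have val_act g v : val (act g v) = coord_act (rho g) (val v).
  exact: (val_tri_act polyP (GP g)).
have act1 v : act 1%g v = v.
  have rho1 : rho 1%g = 1%g by apply: (mulgI (rho 1%g)); rewrite -gmulfM !mulg1.
  by apply: val_inj; rewrite val_act rho1 coord_act1.
have actM g h v : act (g * h)%g v = act g (act h v).
  by apply: val_inj; rewrite !val_act gmulfM coord_actM.
have act_inj g : injective (act g).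
  by apply: (can_inj (g := act g^-1%g)) => v; rewrite -actM mulVg act1.
have act_face g s : s \in faces T -> act g @: s \in faces T.
  exact: (tri_act_face polyP (GP g)).
have act_faceE g (s : {set tri_vertices P}) :
    (act g @: s \in faces T) = (s \in faces T).
  apply/idP/idP => [/(act_face g^-1%g)|]; last exact: act_face.
  rewrite -imset_comp (_ : _ @: s = s) // -[RHS]imset_id.
  by apply: eq_imset => v /=; rewrite -actM mulVg act1.
have [Gam0 [gam0 [prop0 bal0 pres0']]] := tri_balanced_coloring polyP.
have pres0 : preserves_coloring act gam0 by move=> g v; apply: pres0'.
have [Rs [len [Rs_ex Rs_len]]] := tri_shellable polyP unionP.
have flag Gam gam : proper_coloring T gam -> balanced T Gam ->
    preserves_coloring act gam ->
    forall S : {set Gam}, effective (equiv_flag_h (R[i]) T act gam S).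
  by move=> prop bal pres S; apply: shelling_flag_effective Rs_ex Rs_len S.
split=> //.
- exact: translative_coloring prop0 pres0.
- by exists Gam0, gam0.
- apply/funext => m; apply/funext => g.
  rewrite /equiv_hilbert_series (trace_sr_act _ (act_inj g) (act_faceE g)).
  rewrite /equiv_ehrhart_series; case: m => [|m].
    (* In degree 0 the Ehrhart coefficient is 1 by convention, matching the constant monomial. *)
    by rewrite eqxx card_face_monomial0.
  rewrite [_ == _]/= /lattice_character.
  by rewrite (card_fixed_lattice polyP unionP (GP g) (act_inj g)).
(* The h-vector entry is the sum of flag entries over color sets of size [k], for the coloring
   [gam0]. *)
- move=> k kcr; rewrite (_ : equiv_h _ _ _ _ = fun g =>
    \sum_(S : {set Gam0} | #|S| == k) equiv_flag_h (R[i]) T act gam0 S g).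
    by apply: effective_sum => S _; apply: flag.
  by apply/funext => g; apply: equiv_h_flag.
Qed.
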